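(* Let $k$ be a commutative ring with $\mathbb{Q}\subset k$ and let $A$ be a commutative $k$-algebra. Let $(\mathbb{U}^{\mathrm{LR}}_{A/k},\sigma)$ be the enveloping algebra of the Lie–Rinehart algebra $\mathrm{Der}_k(A)$ and $(\mathbb{U}^{\mathrm{HS}}_{A/k},\Upsilon)$ the enveloping algebra of the Hasse–Schmidt derivations of $A$ over $k$. Let $\nabla^{\mathrm{HS}}:\mathrm{Der}_k(A)\to\mathbb{U}^{\mathrm{HS}}_{A/k}$ be the LR-admissible map determined by $\Upsilon^1_{\{0,1\}}(\mathrm{Id}+\delta s)=1+\nabla^{\mathrm{HS}}(\delta)s$ for all $\delta\in\mathrm{Der}_k(A)$, and let $$\boldsymbol\kappa:\mathbb{U}^{\mathrm{LR}}_{A/k}\to\mathbb{U}^{\mathrm{HS}}_{A/k}$$ be the unique map of $k$-algebras over $A$ such that $\boldsymbol\kappa\circ\sigma=\nabla^{\mathrm{HS}}$. Then $\boldsymbol\kappa$ is an isomorphism of filtered $k$-algebras over $A$.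
   Context: Throughout, $k$ is a commutative ring and $A$ a commutative $k$-algebra; $\mathbb{N}=\{0,1,2,\dots\}$; $\mathbf{s}=\{s_1,\dots,s_p\}$, $\mathbf{t}=\{t_1,\dots,t_q\}$ are sets of variables (for $p=1$ the variable is written $s$). Co-ideals and truncated series. $\mathbb{N}^p$ has the componentwise partial order and $|\alpha|=\alpha_1+\cdots+\alpha_p$. A co-ideal of $\mathbb{N}^p$ is a subset $\Delta$ such that $\alpha\in\Delta$, $\alpha'\le\alpha$ imply $\alpha'\in\Delta$. For an abelian group $M$ and a non-empty co-ideal $\Delta$, $M[[\mathbf{s}]]_\Delta$ is the quotient of $M[[\mathbf{s}]]$ by the series with $m_\alpha=0$ for all $\alpha\in\Delta$; its elements are written $\sum_{\alpha\in\Delta}m_\alpha\mathbf{s}^\alpha$. If $R$ is a ring, $R[[\mathbf{s}]]_\Delta$ is a ring (the variables are central), and $\mathcal{U}^p(R;\Delta)$ is the multiplicative group of $r\in R[[\mathbf{s}]]_\Delta$ with $r_0=1$. A $k$-algebra over $A$ is a not necessarily commutative $k$-algebra $R$ with a $k$-algebra map $\iota:A\to R$; elements of $A$ act on $R$ on both sides through $\iota$, and $a\in A$ is also written for $\iota(a)$. It is filtered if it carries an (increasing, exhaustive) ring filtration $(R_d)_{d\ge 0}$ with $\iota(A)\subset R_0$. Maps of (filtered) $k$-algebras over $A$ are maps of (filtered) $k$-algebras compatible with the maps from $A$. Substitution maps. A substitution map $\varphi:A[[\mathbf{s}]]_\Delta\to A[[\mathbf{t}]]_\Omega$ (with $\Delta\subset\mathbb{N}^p$,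 $\Omega\subset\mathbb{N}^q$ non-empty co-ideals) is an $A$-algebra map such that each $\varphi(s_i)$ has zero constant term. For $r=\sum r_\alpha\mathbf{s}^\alpha\in R[[\mathbf{s}]]_\Delta$, $\varphi\bullet r:=\sum_\alpha\varphi(\mathbf{s}^\alpha)r_\alpha\in R[[\mathbf{t}]]_\Omega$. Hasse–Schmidt derivations. $\mathrm{HS}^p_k(A;\Delta)$ is the set of families $D=(D_\alpha)_{\alpha\in\Delta}$ of $k$-linear maps $D_\alpha:A\to A$ with $D_0=\mathrm{Id}$ and $D_\alpha(xy)=\sum_{\beta+\gamma=\alpha}D_\beta(x)D_\gamma(y)$. Identifying $D$ with $\sum_{\alpha\in\Delta}D_\alpha\mathbf{s}^\alpha$, it is a subgroup of $\mathcal{U}^p(\mathrm{End}_k(A);\Delta)$, and $\varphi\bullet D\in\mathrm{HS}^q_k(A;\Omega)$ for every substitution map $\varphi:A[[\mathbf{s}]]_\Delta\to A[[\mathbf{t}]]_\Omega$ with $\Delta\subset\mathbb{N}^p$, $\Omega\subset\mathbb{N}^q$ non-empty co-ideals (known). In particular $\mathrm{HS}^1_k(A;\{0,1\})=\{\mathrm{Id}+\delta s:\delta\in\mathrm{Der}_k(A)\}$. HS-structures. An HS-structure on a $k$-algebra $R$ over $A$ (over $A/k$) is a system of maps $\Psi^p_\Delta:\mathrm{HS}^p_k(A;\Delta)\to\mathcal{U}^p(R;\Delta)$, for $p\in\mathbb{N}$ and $\Delta\subset\mathbb{N}^p$ a non-empty co-ideal, such that: (i) each $\Psi^p_\Delta$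 is a group homomorphism; (ii) $\Psi^p_\Delta(D)\,a=\left(\sum_{\alpha\in\Delta}D_\alpha(a)\mathbf{s}^\alpha\right)\Psi^p_\Delta(D)$ for all $D\in\mathrm{HS}^p_k(A;\Delta)$, $a\in A$; (iii) $\Psi^q_\Omega(\varphi\bullet D)=\varphi\bullet\Psi^p_\Delta(D)$ for every substitution map $\varphi:A[[\mathbf{s}]]_\Delta\to A[[\mathbf{t}]]_\Omega$ and every $D\in\mathrm{HS}^p_k(A;\Delta)$. If $f:R\to R'$ is a map of $k$-algebras over $A$, $f\circ\Psi$ is the HS-structure on $R'$ obtained by applying $f$ to all coefficients. LR-admissible maps. A map $\nabla:\mathrm{Der}_k(A)\to R$ is LR-admissible if it is left $A$-linear, $\nabla(\delta)a=a\nabla(\delta)+\delta(a)1_R$, and $\nabla([\delta,\delta'])=[\nabla(\delta),\nabla(\delta')]$ for all $\delta,\delta'\in\mathrm{Der}_k(A)$, $a\in A$. Every HS-structure $\Psi$ on $R$ gives an LR-admissible map $\nabla$ by $\Psi^1_{\{0,1\}}(\mathrm{Id}+\delta s)=1+\nabla(\delta)s$. Enveloping algebras. $(\mathbb{U}^{\mathrm{LR}}_{A/k},\sigma)$ is the $k$-algebra over $A$ endowed with the universal LR-admissible map $\sigma:\mathrm{Der}_k(A)\to\mathbb{U}^{\mathrm{LR}}_{A/k}$: for any $k$-algebra $R$ over $A$ and any LR-admissible $\psi:\mathrm{Der}_k(A)\to R$ there is a unique map $f:\mathbb{U}^{\mathrm{LR}}_{A/k}\to R$ of $k$-algebras over $A$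 with $f\circ\sigma=\psi$. It is filtered, the $d$-th piece being the additive span of products of elements of (the image of) $A$ and at most $d$ elements $\sigma(\delta)$. $(\mathbb{U}^{\mathrm{HS}}_{A/k},\Upsilon)$ is the $k$-algebra over $A$ endowed with the universal HS-structure $\Upsilon$ over $A/k$: for any $k$-algebra $R$ over $A$ and any HS-structure $\Psi$ on $R$ over $A/k$ there is a unique map $f:\mathbb{U}^{\mathrm{HS}}_{A/k}\to R$ of $k$-algebras over $A$ with $f\circ\Upsilon=\Psi$. It is filtered, the $d$-th piece being the additive span of products of elements of (the image of) $A$ and coefficients $\Upsilon^{p_1}_{\Delta_1}(D_1)_{\alpha_1},\dots,\Upsilon^{p_n}_{\Delta_n}(D_n)_{\alpha_n}$ with $|\alpha_1|+\cdots+|\alpha_n|\le d$. Both exist (known). *)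

(* Defs.v *)
From HB Require Import structures.
From mathcomp Require Import all_boot all_order all_algebra.
From mathcomp Require Import boolp classical_sets functions.
From mathcomp Require Import mpoly.
From mathcomp Require Import ring.

Set Implicit Arguments.
Unset Strict Implicit.
Unset Printing Implicit Defensive.

Import GRing.Theory.
Local Open Scope ring_scope.

(* Sums over the decompositions of a multi-index: the decompositions of [a]   *)
(* only involve multi-indices of degree at most [mdeg a], so the sum below is *)
(* the full sum of [F b c] over all [b + c = a].                              *)
Definition conv p (V : nmodType) (F : 'X_{1..p} -> 'X_{1..p} -> V)
    (a : 'X_{1..p}) : V :=
  \sum_(k : 'X_{1..p < (mdeg a).+1, (mdeg a).+1} | a == (k.1 + k.2)%MM)
     F k.1 k.2.

Section ConvTheory.
Variables (p : nat) (V : nmodType).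
Implicit Types (a b c : 'X_{1..p}) (F : 'X_{1..p} -> 'X_{1..p} -> V).

Lemma bsum_widen (N M : nat) (P : pred 'X_{1..p}) (F : 'X_{1..p} -> V) :
    (forall b, P b -> (mdeg b < N)%N) -> (forall b, P b -> (mdeg b < M)%N) ->
  \sum_(b : 'X_{1..p < N} | P b) F b = \sum_(b : 'X_{1..p < M} | P b) F b.
Proof.
move=> PN PM.
have E K : \sum_(b : 'X_{1..p < K} | P b) F b =
    \sum_(b <- [seq b <- map (@bmnm p K) (index_enum 'X_{1..p < K}) | P b]) F b.
  by rewrite big_filter big_map.
have U K : uniq [seq b <- map (@bmnm p K) (index_enum 'X_{1..p < K}) | P b].
  by rewrite filter_uniq // (map_inj_uniq val_inj) index_enum_uniq.
have Mem K : (forall b, P b -> (mdeg b < K)%N) ->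
    [seq b <- map (@bmnm p K) (index_enum 'X_{1..p < K}) | P b] =i P.
  move=> PK b; rewrite mem_filter /in_mem /=.
  case Pb: (P b) => //=; apply/mapP.
  by exists (BMultinom (PK _ Pb)); rewrite ?mem_index_enum.
rewrite !E; apply/perm_big/uniq_perm => //.
by move=> b; rewrite !Mem.
Qed.

Lemma conv_bound F a N : (mdeg a < N)%N ->
  conv F a =
  \sum_(b : 'X_{1..p < N}) \sum_(c : 'X_{1..p < N} | a == (b + c)%MM) F b c.
Proof.
move=> aN.
transitivity (\sum_(b : 'X_{1..p < (mdeg a).+1})
    \sum_(c : 'X_{1..p < (mdeg a).+1} | a == (b + c)%MM) F b c).
  by rewrite pair_big_dep.
have degL b c : a == (b + c)%MM -> (mdeg b <= mdeg a)%N.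
  by move=> /eqP ->; rewrite mdegD leq_addr.
have degR b c : a == (b + c)%MM -> (mdeg c <= mdeg a)%N.
  by move=> /eqP ->; rewrite mdegD leq_addl.
pose G b := \sum_(c : 'X_{1..p < N} | a == (b + c)%MM) F b c.
have G0 b : ~~ (mdeg b <= mdeg a)%N -> G b = 0.
  by move=> nb; apply: big_pred0 => c; apply: contraNF nb => /degL.
transitivity (\sum_(b : 'X_{1..p < (mdeg a).+1} | (mdeg b <= mdeg a)%N) G b).
  rewrite [RHS]big_rmcond; last by move=> b; exact: G0.
  apply: eq_bigr => b _.
  rewrite (@bsum_widen _ N (fun c => a == (b + c)%MM) (F b)) //.
    by move=> c /degR; rewrite ltnS.
  by move=> c /degR /leq_ltn_trans; apply.
rewrite (@bsum_widen _ N (fun b => (mdeg b <= mdeg a)%N) G) //.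
  by rewrite big_rmcond // => b; exact: G0.
by move=> b /leq_ltn_trans; apply.
Qed.

Lemma eq_conv F G a :
  (forall b c, a = (b + c)%MM -> F b c = G b c) -> conv F a = conv G a.
Proof. by move=> FG; apply: eq_bigr => k /eqP; exact: FG. Qed.

Lemma convC F a : conv F a = conv (fun b c => F c b) a.
Proof.
rewrite (conv_bound _ (ltnSn _)) (conv_bound (fun b c => F c b) (ltnSn _)).
under eq_bigr do rewrite big_mkcond /=.
rewrite exchange_big /=; apply: eq_bigr => c _.
by rewrite [RHS]big_mkcond; apply: eq_bigr => b _; rewrite addmC.
Qed.

Lemma convD F G a :
  conv (fun b c => F b c + G b c) a = conv F a + conv G a.
Proof. exact: big_split. Qed.

Lemma bsum_eq N (P : 'X_{1..p} -> V) b : (mdeg b < N)%N ->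
  \sum_(c : 'X_{1..p < N} | b == c) P c = P b.
Proof.
by move=> bN; rewrite (big_pred1 (BMultinom bN)) // => c; rewrite eq_sym.
Qed.

Lemma conv0l F a : (forall b c, b != 0%MM -> F b c = 0) ->
  conv F a = F 0%MM a.
Proof.
move=> F0; rewrite (conv_bound _ (ltnSn _)).
have N0 : (mdeg (0 : 'X_{1..p})%MM < (mdeg a).+1)%N by rewrite mdeg0.
rewrite (bigD1 (BMultinom N0)) //= [X in _ + X]big1 => [|b nb]; last first.
  by apply: big1 => c _; apply: F0; apply: contra nb => b0; rewrite bmeqP.
rewrite addr0; under eq_bigl do rewrite add0m.
by rewrite (@bsum_eq _ (F 0%MM)).
Qed.

Lemma conv0r F a : (forall b c, c != 0%MM -> F b c = 0) ->
  conv F a = F a 0%MM.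
Proof. by move=> F0; rewrite convC conv0l // => b c; exact: F0. Qed.

Lemma conv_at0 F : conv F 0%MM = F 0%MM 0%MM.
Proof.
rewrite /conv (bigD1 (bm0, bm0)) /=; last by rewrite addm0.
rewrite big1 ?addr0 // => -[b c] /= /andP[/eqP E0 /eqP[]].
have /andP[b0 c0] : (mdeg b == 0%N) && (mdeg c == 0%N).
  by rewrite -addn_eq0 -mdegD -E0 mdeg0.
by congr pair; apply: val_inj; apply/eqP; rewrite -mdeg_eq0.
Qed.

Lemma conv_at1 F i : conv F U_(i)%MM = F 0%MM U_(i)%MM + F U_(i)%MM 0%MM.
Proof.
have uN : (mdeg (U_(i) : 'X_{1..p})%MM < (mdeg (U_(i) : 'X_{1..p})%MM).+1)%N.
  exact: ltnSn.
rewrite /conv (bigD1 (bm0, BMultinom uN)) /=; last by rewrite add0m.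
rewrite (bigD1 (BMultinom uN, bm0)) /=; last first.
  by rewrite addm0 eqxx xpair_eqE bmeqP /= mnm1_eq0.
rewrite big1 ?addr0 // => -[b c] /=; rewrite !xpair_eqE !bmeqP /=.
move: (bmnm b) (bmnm c) => {}b {}c /andP[/andP[/eqP Eu n1] n2]; exfalso.
have : (mdeg b + mdeg c == 1)%N by rewrite -mdegD -Eu mdeg1.
move: n1 n2; have [b0|b0] := eqVneq b 0%MM.
  by move: Eu; rewrite b0 add0m => ->; rewrite eqxx.
have [c0|c0] := eqVneq c 0%MM.
  by move: Eu; rewrite c0 addm0 => ->; rewrite eqxx.
move: b0 c0; rewrite -!mdeg_eq0.
by case: (mdeg b) (mdeg c) => [|?] [|?] //=; rewrite addnS.
Qed.

Let conv3 (G : 'X_{1..p} -> 'X_{1..p} -> 'X_{1..p} -> V) a :=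
  let N := (mdeg a).+1 in
  \sum_(b1 : 'X_{1..p < N}) \sum_(b2 : 'X_{1..p < N})
    \sum_(c : 'X_{1..p < N} | a == (b1 + b2 + c)%MM) G b1 b2 c.

Let convL (G : 'X_{1..p} -> 'X_{1..p} -> 'X_{1..p} -> V) a :
  conv (fun b c => conv (fun b1 b2 => G b1 b2 c) b) a = conv3 G a.
Proof.
rewrite (conv_bound _ (ltnSn _)) /conv3; set N := (mdeg a).+1.
transitivity (\sum_(b : 'X_{1..p < N}) \sum_(c : 'X_{1..p < N})
    \sum_(b1 : 'X_{1..p < N}) \sum_(b2 : 'X_{1..p < N})
      if (a == (b + c)%MM) && (b == (b1 + b2)%MM :> 'X_{1..p})
      then G b1 b2 c else 0).
  apply: eq_bigr => b _; rewrite big_mkcond; apply: eq_bigr => c _.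
  case: ifP => abc /=; last by rewrite big1 // => b1 _; rewrite big1.
  rewrite (conv_bound _ (bmdeg b)); apply: eq_bigr => b1 _.
  by rewrite big_mkcond.
under eq_bigr do rewrite exchange_big /=.
rewrite exchange_big /=; apply: eq_bigr => b1 _.
under eq_bigr do rewrite exchange_big /=.
rewrite exchange_big /=; apply: eq_bigr => b2 _.
rewrite exchange_big /= [RHS]big_mkcond /=; apply: eq_bigr => c _.
case: ifP => abc; last first.
  apply: big1 => b _; case: ifP => // /andP[/eqP ab /eqP bb].
  by rewrite -bb -ab eqxx in abc.
have bN : (mdeg (b1 + b2)%MM < N)%N.
  by rewrite ltnS (eqP abc) (mdegD (b1 + b2)) leq_addr.
rewrite (bigD1 (BMultinom bN)) //= abc eqxx [X in _ + X]big1 ?addr0 // => b nb.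
case: ifP => // /andP[_ /eqP bb]; case/eqP: nb; exact: val_inj.
Qed.

Lemma convA (G : 'X_{1..p} -> 'X_{1..p} -> 'X_{1..p} -> V) a :
  conv (fun b c => conv (fun b1 b2 => G b1 b2 c) b) a =
  conv (fun b c => conv (fun c1 c2 => G b c1 c2) c) a.
Proof.
rewrite convL [RHS]convC (convL (fun c1 c2 b => G b c1 c2)).
rewrite /conv3; set N := _.+1.
under [RHS]eq_bigr => b1 _.
  under eq_bigr => b2 _ do rewrite big_mkcond.
  rewrite exchange_big; over.
rewrite [RHS]exchange_big /=; apply: eq_bigr => b _.
apply: eq_bigr => c _; rewrite big_mkcond; apply: eq_bigr => d _.
by rewrite [X in a == X](_ : _ = c + d + b)%MM // [RHS]addmC addmA.
Qed.

Lemma convACA (G : 'X_{1..p} -> 'X_{1..p} -> 'X_{1..p} -> 'X_{1..p} -> V) a :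
  conv (fun b c => conv (fun b1 b2 => conv (fun c1 c2 => G b1 b2 c1 c2) c) b) a =
  conv (fun b c => conv (fun b1 c1 => conv (fun b2 c2 => G b1 b2 c1 c2) c) b) a.
Proof.
rewrite (convA (fun b1 b2 c => conv (fun c1 c2 => G b1 b2 c1 c2) c)).
rewrite (convA (fun b1 c1 c => conv (fun b2 c2 => G b1 b2 c1 c2) c)).
apply: eq_conv => b1 r _.
rewrite -(convA (fun b2 c1 c2 => G b1 b2 c1 c2)).
rewrite -(convA (fun c1 b2 c2 => G b1 b2 c1 c2)).
by apply: eq_conv => s c2 _; rewrite convC.
Qed.

End ConvTheory.

Record coideal p := Coideal {
  coideal_set :> 'X_{1..p} -> Prop;
  coideal_neq0 : exists a, coideal_set a;
  coideal_le : forall a b, coideal_set a -> (b <= a)%MM -> coideal_set b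
}.

Lemma coideal0 p (Delta : coideal p) : Delta 0%MM.
Proof.
have [a Da] := coideal_neq0 Delta.
by apply: coideal_le Da _; apply/mnm_lepP => i; rewrite mnm0E.
Qed.

Lemma coidealDl p (Delta : coideal p) a b : Delta (a + b)%MM -> Delta a.
Proof. by move=> /coideal_le; apply; exact: lem_addr. Qed.

Lemma coidealDr p (Delta : coideal p) a b : Delta (a + b)%MM -> Delta b.
Proof. by rewrite addmC; exact: coidealDl. Qed.

(* M[[s]]_Delta: since two series are identified when they have the same      *)
(* coefficients on Delta, an element is a family indexed by Delta.            *)
Definition tseries (M : Type) p (Delta : coideal p) : Type :=
  {a : 'X_{1..p} | `[< Delta a >]} -> M.

Section TSeriesZmod.
Variables (M : zmodType) (p : nat) (Delta : coideal p).
Implicit Types (f g : tseries M Delta) (a : 'X_{1..p}).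

HB.instance Definition _ := GRing.Zmodule.copy (tseries M Delta)
  ({a : 'X_{1..p} | `[< Delta a >]} -> M).

(* The coefficient of s^a, which is set to 0 when a is not in Delta. *)
Definition tcoef f a : M := oapp f 0 (insub a).

Definition mkts (F : 'X_{1..p} -> M) : tseries M Delta := fun u => F (val u).

Lemma tcoef_mk F a : Delta a -> tcoef (mkts F) a = F a.
Proof.
by move=> Da; rewrite /tcoef insubT ?asboolT //= => Da'; rewrite /mkts SubK.
Qed.

Lemma tcoef_out f a : ~ Delta a -> tcoef f a = 0.
Proof. by move=> Da; rewrite /tcoef insubF //; exact: asboolF. Qed.

Lemma tseriesP f g : (forall a, Delta a -> tcoef f a = tcoef g a) -> f = g.
Proof.
move=> fg; apply/funext => u; have := fg (val u).
rewrite /tcoef valK /=; apply; exact/asboolP/(valP u).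
Qed.

Lemma tcoef0 a : tcoef 0 a = 0.
Proof. by rewrite /tcoef; case: insubP. Qed.

Lemma tcoefD f g a : tcoef (f + g) a = tcoef f a + tcoef g a.
Proof. by rewrite /tcoef; case: insubP => [u _ _|_] //=; rewrite addr0. Qed.

End TSeriesZmod.

Section TSeriesRing.
Variables (R : pzRingType) (p : nat) (Delta : coideal p).
Implicit Types (f g h : tseries R Delta) (a : 'X_{1..p}).

Definition tone : tseries R Delta := mkts (fun a => (a == 0%MM)%:R).

Definition tmul f g : tseries R Delta :=
  mkts (conv (fun b c => tcoef f b * tcoef g c)).

Let tcoef_mul f g a : Delta a ->
  tcoef (tmul f g) a = conv (fun b c => tcoef f b * tcoef g c) a.
Proof. exact: tcoef_mk. Qed.

Let conv_mull (F : 'X_{1..p} -> 'X_{1..p} -> R) x a :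
  conv F a * x = conv (fun b c => F b c * x) a.
Proof. exact: mulr_suml. Qed.

Let conv_mulr (F : 'X_{1..p} -> 'X_{1..p} -> R) x a :
  x * conv F a = conv (fun b c => x * F b c) a.
Proof. exact: mulr_sumr. Qed.

Let tmulA : associative tmul.
Proof.
move=> f g h; apply: tseriesP => a Da; rewrite !tcoef_mul //.
rewrite (@eq_conv _ _ _ (fun b c =>
    conv (fun c1 c2 => tcoef f b * (tcoef g c1 * tcoef h c2)) c)); last first.
  move=> b c E; rewrite E in Da.
  by rewrite tcoef_mul ?conv_mulr //; exact: coidealDr Da.
rewrite -(convA (fun b c1 c2 => tcoef f b * (tcoef g c1 * tcoef h c2))).
apply: eq_conv => b c E; rewrite E in Da.
rewrite tcoef_mul ?conv_mull; last exact: coidealDl Da.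
by apply: eq_conv => b1 b2 _; rewrite mulrA.
Qed.

Let tcoef_one a : tcoef tone a = (a == 0%MM)%:R.
Proof.
have [Da|Da] := pselect (Delta a); first exact: tcoef_mk.
by rewrite tcoef_out //; case: eqP => // E; case: Da; rewrite E; exact: coideal0.
Qed.

Let tmul1l : left_id tone tmul.
Proof.
move=> f; apply: tseriesP => a Da; rewrite tcoef_mul // conv0l.
  by rewrite tcoef_one eqxx mul1r.
by move=> b c /negbTE nb; rewrite tcoef_one nb mul0r.
Qed.

Let tmul1r : right_id tone tmul.
Proof.
move=> f; apply: tseriesP => a Da; rewrite tcoef_mul // conv0r.
  by rewrite tcoef_one eqxx mulr1.
by move=> b c /negbTE nb; rewrite tcoef_one nb mulr0.
Qed.

Let tmulDl : left_distributive tmul +%R.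
Proof.
move=> f g h; apply: tseriesP => a Da; rewrite tcoefD !tcoef_mul // -convD.
by apply: eq_conv => b c _; rewrite tcoefD mulrDl.
Qed.

Let tmulDr : right_distributive tmul +%R.
Proof.
move=> f g h; apply: tseriesP => a Da; rewrite tcoefD !tcoef_mul // -convD.
by apply: eq_conv => b c _; rewrite tcoefD mulrDr.
Qed.

HB.instance Definition _ := GRing.Zmodule_isPzRing.Build (tseries R Delta)
  tmulA tmul1l tmul1r tmulDl tmulDr.

Lemma tcoefM f g a : Delta a ->
  tcoef (f * g) a = conv (fun b c => tcoef f b * tcoef g c) a.
Proof. exact: tcoef_mul. Qed.

Lemma tcoef1 a : tcoef (1 : tseries R Delta) a = (a == 0%MM)%:R.
Proof. exact: tcoef_one. Qed.

Definition tconst (r : R) : tseries R Delta :=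
  mkts (fun a => if a == 0%MM then r else 0).

(* The class of the monomial s^a, which is 0 when a is not in Delta. *)
Definition tmonom a : tseries R Delta := mkts (fun b => (b == a)%:R).

Definition tvar (i : 'I_p) : tseries R Delta := tmonom U_(i)%MM.

Lemma tcoef_monom a b :
  tcoef (tmonom a) b = (`[< Delta b >] && (b == a))%:R.
Proof. by case: asboolP => Db; [rewrite tcoef_mk | rewrite tcoef_out]. Qed.

Lemma tmonom_out a : ~ Delta a -> tmonom a = 0.
Proof.
move=> Da; apply: tseriesP => b Db; rewrite tcoef_monom asboolT //=.
by rewrite tcoef0; case: eqP => // E; case: Da; rewrite -E.
Qed.

Lemma tmonom0 : tmonom 0%MM = 1.
Proof.
by apply: tseriesP => a Da; rewrite tcoef_monom asboolT //= tcoef1.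
Qed.

Lemma tmonomD a b : tmonom (a + b)%MM = tmonom a * tmonom b.
Proof.
apply: tseriesP => c Dc; rewrite tcoefM // tcoef_monom asboolT //=.
have [E | ncab] := eqVneq c (a + b)%MM; last first.
  rewrite /conv big1 // => -[b' c'] /= /eqP E.
  rewrite !tcoef_monom.
  case: eqP => [Ea|]; last by rewrite andbF mul0r.
  case: eqP => [Eb|]; last by rewrite andbF mulr0.
  by rewrite E Ea Eb eqxx in ncab.
have Da : Delta a by move: Dc; rewrite E; exact: coidealDl.
have Db : Delta b by move: Dc; rewrite E; exact: coidealDr.
have aN : (mdeg a < (mdeg c).+1)%N by rewrite ltnS E mdegD leq_addr.
have bN : (mdeg b < (mdeg c).+1)%N by rewrite ltnS E mdegD leq_addl.
rewrite (conv_bound _ (ltnSn _)) (bigD1 (BMultinom aN)) //=.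
rewrite (bigD1 (BMultinom bN)) -?E ?eqxx //= !tcoef_monom !asboolT // !eqxx mulr1.
rewrite big1 ?addr0 => [|c' /andP[_ nc]]; last first.
  by rewrite bmeqP /= in nc; rewrite !tcoef_monom (negbTE nc) andbF mulr0.
rewrite big1 ?addr0 // => b' nb; apply: big1 => c' _.
by rewrite bmeqP /= in nb; rewrite tcoef_monom (negbTE nb) andbF mul0r.
Qed.

Lemma tcoef_constM r f a : tcoef (tconst r * f) a = r * tcoef f a.
Proof.
have [Da|Da] := pselect (Delta a); last by rewrite !tcoef_out // mulr0.
have cr b : tcoef (tconst r) b = if b == 0%MM then r else 0.
  have [Db|Db] := pselect (Delta b); first exact: tcoef_mk.
  rewrite tcoef_out //; case: eqP => // E; case: Db; rewrite E.
  exact: coideal0.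
rewrite tcoefM // conv0l ?cr ?eqxx // => b c /negbTE nb.
by rewrite cr nb mul0r.
Qed.

End TSeriesRing.

Arguments tconst {R p} Delta r.
Arguments tmonom R {p} Delta a.
Arguments tvar R {p} Delta i.

Section Substitution.
Variable A : comPzRingType.

Record substmap p q (Delta : coideal p) (Omega : coideal q) := SubstMap {
  subst_fun :> {rmorphism tseries A Delta -> tseries A Omega};
  subst_const : forall a : A, subst_fun (tconst Delta a) = tconst Omega a;
  subst_var0 : forall i, tcoef (subst_fun (tvar A Delta i)) 0%MM = 0
}.

Variables (p q : nat) (Delta : coideal p) (Omega : coideal q).
Variable phi : substmap Delta Omega.

Lemma subst_monom_low a e : (mdeg e < mdeg a)%N ->
  tcoef (phi (tmonom A Delta a)) e = 0.
Proof.
move: {-1}(mdeg a) (erefl (mdeg a)) => n.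
elim: n a e => [//|n IH] a e Ea; rewrite ltnS => en.
have [Oe|] := pselect (Omega e); last by move=> /tcoef_out ->.
have [i ai] : exists i, (U_(i) <= a)%MM.
  have /mnmP an0 : a <> 0%MM by move=> a0; rewrite a0 mdeg0 in Ea.
  have [i ai] : exists i, a i != 0%N.
    by apply: contrapT => nai; case: an0 => i; rewrite mnm0E;
       apply/eqP/negPn/negP => ai; apply: nai; exists i.
  by exists i; rewrite lep1mP.
rewrite -(submK ai) addmC tmonomD rmorphM tcoefM //.
apply: big1 => -[b c] /=; move: (bmnm b) (bmnm c) => {}b {}c /eqP Ebc.
have [-> | b0] := eqVneq b 0%MM.
  by have := subst_var0 phi i; rewrite /tvar => ->; rewrite mul0r.
rewrite [X in _ * X](IH _ c) ?mulr0 //.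
  by apply: succn_inj; rewrite -Ea -[in RHS](submK ai) mdegD mdeg1 addn1.
apply: leq_trans en; rewrite Ebc mdegD -[X in (X < _)%N]add0n ltn_add2r.
by rewrite lt0n mdeg_eq0.
Qed.

(* The sum of the phi(s^a) r_a, over all a in Delta. As phi(s^a) has no       *)
(* coefficient of degree less than mdeg a (subst_monom_low), only the a of    *)
(* degree at most mdeg e contribute to the coefficient of t^e; and r has zero *)
(* coefficients out of Delta.                                                 *)
Definition subst_act (R : pzRingType) (iota : {rmorphism A -> R})
    (r : tseries R Delta) : tseries R Omega :=
  mkts (fun e => \sum_(a : 'X_{1..p < (mdeg e).+1})
                    iota (tcoef (phi (tmonom A Delta a)) e) * tcoef r a).

End Substitution.

Section KEnd.
Variables (k A : comPzRingType) (eta : {rmorphism k -> A}).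

(* End_k(A), where A is a k-algebra through eta. *)
Record kend := KEnd {
  kend_fun :> A -> A;
  kendD : {morph kend_fun : x y / x + y};
  kendZ : forall c x, kend_fun (eta c * x) = eta c * kend_fun x
}.

HB.instance Definition _ := gen_eqMixin kend.
HB.instance Definition _ := gen_choiceMixin kend.

Lemma kendP (f g : kend) : f =1 g -> f = g.
Proof.
case: f g => [f f1 f2] [g g1 g2] /= /funext fg; rewrite fg in f1 f2 *.
by congr KEnd; exact: Prop_irrelevance.
Qed.

Program Definition kend_zero := @KEnd (fun=> 0) _ _.
Next Obligation. by move=> x y; rewrite addr0. Qed.
Next Obligation. by rewrite mulr0. Qed.

Program Definition kend_add (f g : kend) := @KEnd (fun x => f x + g x) _ _.
Next Obligation. by move=> x y; rewrite !kendD addrACA. Qed.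
Next Obligation. by rewrite !kendZ mulrDr. Qed.

Program Definition kend_opp (f : kend) := @KEnd (fun x => - f x) _ _.
Next Obligation. by move=> x y; rewrite kendD opprD. Qed.
Next Obligation. by rewrite kendZ mulrN. Qed.

Program Definition kend_one := @KEnd id _ _.
Next Obligation. by []. Qed.

Program Definition kend_mul (f g : kend) := @KEnd (fun x => f (g x)) _ _.
Next Obligation. by move=> x y; rewrite !kendD. Qed.
Next Obligation. by rewrite !kendZ. Qed.

Let kaddA : associative kend_add.
Proof. by move=> f g h; apply: kendP => x /=; rewrite addrA. Qed.
Let kaddC : commutative kend_add.
Proof. by move=> f g; apply: kendP => x /=; rewrite addrC. Qed.
Let kadd0 : left_id kend_zero kend_add.
Proof. by move=> f; apply: kendP => x /=; rewrite add0r. Qed.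
Let kaddN : left_inverse kend_zero kend_opp kend_add.
Proof. by move=> f; apply: kendP => x /=; rewrite addNr. Qed.

HB.instance Definition _ := GRing.isZmodule.Build kend kaddA kaddC kadd0 kaddN.

Let kmulA : associative kend_mul.
Proof. by move=> f g h; apply: kendP. Qed.
Let kmul1l : left_id kend_one kend_mul.
Proof. by move=> f; apply: kendP. Qed.
Let kmul1r : right_id kend_one kend_mul.
Proof. by move=> f; apply: kendP. Qed.
Let kmulDl : left_distributive kend_mul +%R.
Proof. by move=> f g h; apply: kendP. Qed.
Let kmulDr : right_distributive kend_mul +%R.
Proof. by move=> f g h; apply: kendP => x /=; rewrite kendD. Qed.

HB.instance Definition _ :=
  GRing.Zmodule_isPzRing.Build kend kmulA kmul1l kmul1r kmulDl kmulDr.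

Lemma kendDE (f g : kend) x : (f + g) x = f x + g x. Proof. by []. Qed.
Lemma kend1E x : (1 : kend) x = x. Proof. by []. Qed.
Lemma kendME (f g : kend) x : (f * g) x = f (g x). Proof. by []. Qed.

Lemma kend_sumE (I : Type) (r : seq I) (P : pred I) (F : I -> kend) x :
  (\sum_(i <- r | P i) F i) x = \sum_(i <- r | P i) F i x.
Proof. exact: (big_morph (fun f : kend => f x)). Qed.

Lemma kend_raddf0 (f : kend) : f 0 = 0.
Proof. by apply: (addrI (f 0)); rewrite -kendD !addr0. Qed.

(* A acts on itself by multiplication, which makes End_k(A) an algebra over A. *)
Program Definition kendC (a : A) := @KEnd ( *%R a) _ _.
Next Obligation. by move=> x y; rewrite mulrDr. Qed.
Next Obligation. by rewrite mulrCA. Qed.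

Let kendC_additive : zmod_morphism kendC.
Proof. by move=> a b; apply: kendP => x /=; rewrite mulrBl. Qed.
Let kendC_multiplicative : monoid_morphism kendC.
Proof.
by split=> [|a b]; apply: kendP => x /=; rewrite ?mul1r ?mulrA.
Qed.
HB.instance Definition _ := GRing.isZmodMorphism.Build A kend kendC kendC_additive.
HB.instance Definition _ :=
  GRing.isMonoidMorphism.Build A kend kendC kendC_multiplicative.

Record der := Der {
  der_end :> kend;
  derM : forall x y, der_end (x * y) = der_end x * y + x * der_end y
}.

HB.instance Definition _ := gen_eqMixin der.
HB.instance Definition _ := gen_choiceMixin der.

Lemma derP (d d' : der) : d =1 d' -> d = d'.
Proof.
case: d d' => [f f1] [g g1] /= /kendP fg; rewrite fg in f1 *.
by congr Der; exact: Prop_irrelevance.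
Qed.

Program Definition der_zero := @Der 0 _.
Next Obligation. by rewrite mulr0 mul0r addr0. Qed.

Program Definition der_add (d d' : der) := @Der (der_end d + der_end d') _.
Next Obligation. by rewrite !derM mulrDl mulrDr addrACA. Qed.

Program Definition der_opp (d : der) := @Der (- der_end d) _.
Next Obligation. by rewrite !derM opprD mulNr mulrN. Qed.

Program Definition der_scale (a : A) (d : der) := @Der (kendC a * der_end d) _.
Next Obligation. by rewrite derM mulrDr mulrA [a * (_ * _)]mulrCA. Qed.

Program Definition der_bracket (d d' : der) :=
  @Der (der_end d * der_end d' - der_end d' * der_end d) _.
Next Obligation.
rewrite !derM !kendD !derM; ring.
Qed.

Let daddA : associative der_add.
Proof. by move=> f g h; apply: derP => x /=; rewrite addrA. Qed.
Let daddC : commutative der_add.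
Proof. by move=> f g; apply: derP => x /=; rewrite addrC. Qed.
Let dadd0 : left_id der_zero der_add.
Proof. by move=> f; apply: derP => x /=; rewrite add0r. Qed.
Let daddN : left_inverse der_zero der_opp der_add.
Proof. by move=> f; apply: derP => x /=; rewrite addNr. Qed.

HB.instance Definition _ := GRing.isZmodule.Build der daddA daddC dadd0 daddN.

Let dscaleA a b d : der_scale a (der_scale b d) = der_scale (a * b) d.
Proof. by apply: derP => x /=; rewrite mulrA. Qed.
Let dscale1 : left_id 1 der_scale.
Proof. by move=> d; apply: derP => x /=; rewrite mul1r. Qed.
Let dscaleDr : right_distributive der_scale +%R.
Proof. by move=> a d d'; apply: derP => x /=; rewrite mulrDr. Qed.
Let dscaleDl d : {morph der_scale^~ d : a b / a + b}.
Proof. by move=> a b; apply: derP => x /=; rewrite mulrDl. Qed.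

HB.instance Definition _ :=
  GRing.Zmodule_isLmodule.Build A der dscaleA dscale1 dscaleDr dscaleDl.

End KEnd.

Section HasseSchmidt.
Variables (k A : comPzRingType) (eta : {rmorphism k -> A}).

Record HS p (Delta : coideal p) := HSder {
  HS_series :> tseries (kend eta) Delta;
  HS_coef0 : tcoef HS_series 0%MM = 1;
  HS_coefM : forall a, Delta a -> forall x y,
    tcoef HS_series a (x * y) =
    conv (fun b c => tcoef HS_series b x * tcoef HS_series c y) a
}.

Let kend_conv p (F : 'X_{1..p} -> 'X_{1..p} -> kend eta) a x :
  conv F a x = conv (fun b c => F b c x) a.
Proof. exact: kend_sumE. Qed.

Let conv_kend p (f : kend eta) (F : 'X_{1..p} -> 'X_{1..p} -> A) a :
  f (conv F a) = conv (fun b c => f (F b c)) a.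
Proof. by apply: (big_morph f (kendD f)); exact: kend_raddf0. Qed.

Section Product.
Variables (p : nat) (Delta : coideal p) (D E : HS Delta).

Let DE : tseries (kend eta) Delta := HS_series D * HS_series E.

Let mul_coef0 : tcoef DE 0%MM = 1.
Proof.
by rewrite tcoefM ?conv_at0 ?HS_coef0 ?mulr1 //; exact: coideal0.
Qed.

Let mul_coefM a : Delta a -> forall x y,
  tcoef DE a (x * y) = conv (fun b c => tcoef DE b x * tcoef DE c y) a.
Proof.
move=> Da x y; rewrite tcoefM // kend_conv.
transitivity (conv (fun b c => conv (fun b1 b2 => conv (fun c1 c2 =>
    tcoef D b1 (tcoef E c1 x) * tcoef D b2 (tcoef E c2 y)) c) b) a).
  apply: eq_conv => b c Ea; rewrite Ea in Da.
  rewrite kendME HS_coefM; last exact: coidealDr Da.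
  rewrite conv_kend [RHS]exchange_big; apply: eq_bigr => -[c1 c2] _ /=.
  by rewrite HS_coefM; last exact: coidealDl Da.
rewrite convACA; apply: eq_conv => m n Ea; rewrite Ea in Da.
rewrite !tcoefM ?kend_conv; last 2 first.
- exact: coidealDr Da.
- exact: coidealDl Da.
rewrite /conv mulr_suml; apply: eq_bigr => -[b1 c1] _ /=.
by rewrite mulr_sumr.
Qed.

Definition HS_mul : HS Delta := HSder mul_coef0 mul_coefM.

End Product.

Section Action.
Variables (p q : nat) (Delta : coideal p) (Omega : coideal q).
Variables (phi : @substmap A p q Delta Omega) (D : HS Delta).

Let c a e : A := tcoef (phi (tmonom A Delta a)) e.

Let phiD : tseries (kend eta) Omega := subst_act phi (kendC eta) D.

Let phiDE e x N : Omega e -> (mdeg e < N)%N ->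
  tcoef phiD e x = \sum_(a : 'X_{1..p < N}) c a e * tcoef D a x.
Proof.
move=> Oe eN; rewrite tcoef_mk // kend_sumE /=.
pose G a := c a e * tcoef D a x.
have G0 a : ~~ (mdeg a <= mdeg e)%N -> G a = 0.
  by rewrite -ltnNge => ea; rewrite /G /c subst_monom_low // mul0r.
transitivity (\sum_(a : 'X_{1..p < (mdeg e).+1} | (mdeg a <= mdeg e)%N) G a).
  by rewrite [RHS]big_rmcond // => a; exact: G0.
rewrite (@bsum_widen _ _ _ N (fun a => (mdeg a <= mdeg e)%N) G) //.
  by rewrite big_rmcond // => a; exact: G0.
by move=> b /leq_ltn_trans; apply.
Qed.

Let act_coef0 : tcoef phiD 0%MM = 1.
Proof.
apply: kendP => x; rewrite (@phiDE _ _ 1) ?mdeg0 //; last exact: coideal0.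
rewrite (bigD1 bm0) //= big1 => [|a]; last first.
  by rewrite bmeqP -mdeg_eq0 -leqn0 -ltnS bmdeg.
by rewrite /c tmonom0 rmorph1 tcoef1 eqxx HS_coef0 mul1r addr0.
Qed.

Let cD b b' e : Omega e ->
  c (b + b')%MM e = conv (fun e1 e2 => c b e1 * c b' e2) e.
Proof. by move=> Oe; rewrite /c tmonomD rmorphM tcoefM. Qed.

Let act_coefM e : Omega e -> forall x y,
  tcoef phiD e (x * y) = conv (fun e1 e2 => tcoef phiD e1 x * tcoef phiD e2 y) e.
Proof.
move=> Oe x y; set N := (mdeg e).+1; rewrite (@phiDE _ _ N) //.
pose T b b' := tcoef D b x * tcoef D b' y.
transitivity (\sum_(b : 'X_{1..p < N}) \sum_(b' : 'X_{1..p < N})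
    c (b + b')%MM e * T b b').
  transitivity (\sum_(a : 'X_{1..p < N}) \sum_(b : 'X_{1..p < N})
      \sum_(b' : 'X_{1..p < N} | a == (b + b')%MM :> 'X_{1..p})
        c (b + b')%MM e * T b b').
    apply: eq_bigr => a _; have [Da|Da] := pselect (Delta a); last first.
      rewrite /c tmonom_out // rmorph0 tcoef0 mul0r big1 // => b _.
      by apply: big1 => b' /eqP <-; rewrite tmonom_out // rmorph0 tcoef0 mul0r.
    rewrite HS_coefM // (conv_bound _ (bmdeg a)) mulr_sumr.
    by apply: eq_bigr => b _; rewrite mulr_sumr; apply: eq_bigr => b' /eqP <-.
  rewrite exchange_big; apply: eq_bigr => b _ /=.
  under eq_bigr do rewrite big_mkcond.
  rewrite exchange_big; apply: eq_bigr => b' _ /=.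
  rewrite -big_mkcond; have [bN|Nb] := ltnP (mdeg (b + b')%MM) N.
    by rewrite (big_pred1 (BMultinom bN)).
  rewrite big_pred0 => [|a]; last first.
    by apply: contraTF Nb => /eqP <-; rewrite -ltnNge bmdeg.
  by rewrite /c subst_monom_low // mul0r.
transitivity (conv (fun e1 e2 =>
    (\sum_(b : 'X_{1..p < N}) c b e1 * tcoef D b x) *
    (\sum_(b' : 'X_{1..p < N}) c b' e2 * tcoef D b' y)) e); last first.
  apply: eq_conv => e1 e2 Ee; rewrite Ee in Oe.
  rewrite (@phiDE e1 x N) ?(@phiDE e2 y N) //.
  - exact: coidealDr Oe.
  - by rewrite ltnS Ee mdegD leq_addl.
  - exact: coidealDl Oe.
  - by rewrite ltnS Ee mdegD leq_addr.
under [RHS]eq_bigr do rewrite mulr_suml.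
rewrite [RHS]exchange_big; apply: eq_bigr => b _ /=.
under [RHS]eq_bigr do rewrite mulr_sumr.
rewrite [RHS]exchange_big; apply: eq_bigr => b' _ /=.
by rewrite cD // mulr_suml; apply: eq_bigr => e' _; rewrite mulrACA.
Qed.

Definition HS_subst : HS Omega := HSder act_coef0 act_coefM.

End Action.

End HasseSchmidt.

Program Definition coideal01 : coideal 1 :=
  @Coideal 1 (fun a => a ord0 <= 1)%N _ _.
Next Obligation. by exists 0%MM; rewrite mnm0E. Qed.
Next Obligation.
by move: H0 => /mnm_lepP /(_ ord0) /leq_trans; apply.
Qed.

Section IdPlusDer.
Variables (k A : comPzRingType) (eta : {rmorphism k -> A}) (d : der eta).

Let Dd : tseries (kend eta) coideal01 :=
  1 + tconst coideal01 (der_end d) * tvar _ coideal01 ord0.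

Let DdE a : coideal01 a -> tcoef Dd a = if a == 0%MM then 1 else der_end d.
Proof.
move=> Da; rewrite tcoefD tcoef1 tcoef_constM tcoef_monom asboolT //=.
have [->|an0] := eqVneq a 0%MM.
  by rewrite eq_sym mnm1_eq0 mulr0 addr0.
have -> : a = U_(ord0)%MM.
  apply/mnmP => i; rewrite (ord1 i) mnm1E eqxx.
  apply/eqP; rewrite eqn_leq Da lt0n; apply: contra an0 => /eqP a0.
  by apply/eqP/mnmP => j; rewrite (ord1 j) a0 mnm0E.
by rewrite eqxx mulr1 add0r.
Qed.

Let Dd_coef0 : tcoef Dd 0%MM = 1.
Proof. by rewrite DdE ?eqxx //; exact: coideal0. Qed.

Let Dd_coefM a : coideal01 a -> forall x y,
  tcoef Dd a (x * y) = conv (fun b c => tcoef Dd b x * tcoef Dd c y) a.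
Proof.
move=> Da x y; have [a0|an0] := eqVneq a 0%MM.
  by rewrite a0 conv_at0 !Dd_coef0.
have U1 : coideal01 U_(ord0)%MM by rewrite /= mnm1E eqxx.
have aU : a = U_(ord0)%MM.
  apply/mnmP => i; rewrite (ord1 i) mnm1E eqxx.
  apply/eqP; rewrite eqn_leq Da lt0n; apply: contra an0 => /eqP a0.
  by apply/eqP/mnmP => j; rewrite (ord1 j) a0 mnm0E.
rewrite aU conv_at1 !Dd_coef0 !DdE // mnm1_eq0 !kend1E derM.
exact: addrC.
Qed.

(* Id + d s *)
Definition HS_of_der : HS eta coideal01 := HSder Dd_coef0 Dd_coefM.

End IdPlusDer.

Section AlgebrasOver.
Variables (k A : comPzRingType) (eta : {rmorphism k -> A}).

(* A k-algebra R over A, not necessarily commutative; its k-algebra structure *)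
(* is the one given by the central ring map alg_map \o eta : k -> R.          *)
Record alg_over := AlgOver {
  alg_ring :> pzRingType;
  alg_map : {rmorphism A -> alg_ring};
  alg_central : forall c r, alg_map (eta c) * r = r * alg_map (eta c)
}.

Record alg_mor (R R' : alg_over) := AlgMor {
  alg_fun :> {rmorphism R -> R'};
  alg_funE : forall a, alg_fun (alg_map R a) = alg_map R' a
}.

(* Sending D in HS^p_k(A; Delta) to U^p(R; Delta). A multiplicative map       *)
(* between groups is a group homomorphism.                                    *)
Record HS_structure (R : alg_over) := HSStructure {
  hs_map :> forall p (Delta : coideal p), HS eta Delta -> tseries R Delta;
  hs_coef0 : forall p (Delta : coideal p) (D : HS eta Delta),
    tcoef (hs_map D) 0%MM = 1;
  hs_mul : forall p (Delta : coideal p) (D E : HS eta Delta),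
    hs_map (HS_mul D E) = hs_map D * hs_map E;
  hs_leibniz : forall p (Delta : coideal p) (D : HS eta Delta) (a : A),
    hs_map D * tconst Delta (alg_map R a) =
    mkts (fun b => alg_map R (tcoef D b a)) * hs_map D;
  hs_subst : forall p q (Delta : coideal p) (Omega : coideal q)
      (phi : substmap A Delta Omega) (D : HS eta Delta),
    hs_map (HS_subst phi D) = subst_act phi (alg_map R) (hs_map D)
}.

Record LR_map (R : alg_over) := LRMap {
  lr_map :> der eta -> R;
  lr_linear : forall a d d',
    lr_map (a *: d + d') = alg_map R a * lr_map d + lr_map d';
  lr_leibniz : forall d a,
    lr_map d * alg_map R a = alg_map R a * lr_map d + alg_map R (der_end d a);
  lr_bracket : forall d d',
    lr_map (der_bracket d d') = lr_map d * lr_map d' - lr_map d' * lr_map d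
}.

Definition is_LR_envelope (U : alg_over) (sigma : LR_map U) : Prop :=
  forall (R : alg_over) (psi : LR_map R),
    exists f : alg_mor U R,
      (forall d, f (sigma d) = psi d) /\
      (forall g : alg_mor U R, (forall d, g (sigma d) = psi d) -> g =1 f).

Definition hs_compatible (U R : alg_over) (Ups : HS_structure U)
    (Psi : HS_structure R) (f : alg_mor U R) : Prop :=
  forall p (Delta : coideal p) (D : HS eta Delta),
    mkts (fun a => f (tcoef (Ups p Delta D) a)) = Psi p Delta D.

Definition is_HS_envelope (U : alg_over) (Ups : HS_structure U) : Prop :=
  forall (R : alg_over) (Psi : HS_structure R),
    exists f : alg_mor U R,
      hs_compatible Ups Psi f /\
      (forall g : alg_mor U R, hs_compatible Ups Psi g -> g =1 f).

End AlgebrasOver.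

Section Filtration.
Variable R : pzRingType.

Inductive weighted_product (gen : nat -> R -> Prop) : nat -> R -> Prop :=
| WProdNil : weighted_product gen 0 1
| WProdCons n x m y : gen n x -> weighted_product gen m y ->
    weighted_product gen (n + m) (x * y).

(* [gen n x] means that x is a generator of weight n; the d-th piece is the   *)
(* additive span of the products of generators of total weight at most d.     *)
Definition filtration (gen : nat -> R -> Prop) (d : nat) (x : R) : Prop :=
  let P y := exists2 m, (m <= d)%N & weighted_product gen m y in
  exists2 s : seq R, (forall y, y \in s -> P y \/ P (- y)) &
    x = \sum_(y <- s) y.

End Filtration.

Section Enveloping.
Variables (k A : comPzRingType) (eta : {rmorphism k -> A}) (U : alg_over eta).

Definition LR_generator (sigma : LR_map U) (n : nat) (x : U) : Prop :=
  (n = 0%N /\ exists a, x = alg_map U a) \/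
  (n = 1%N /\ exists d, x = sigma d).

Definition LR_filtration (sigma : LR_map U) := filtration (LR_generator sigma).

Definition HS_generator (Ups : HS_structure U) (n : nat) (x : U) : Prop :=
  (n = 0%N /\ exists a, x = alg_map U a) \/
  exists p (Delta : coideal p) (D : HS eta Delta) (b : 'X_{1..p}),
    [/\ Delta b, n = mdeg b & x = tcoef (Ups p Delta D) b].

Definition HS_filtration (Ups : HS_structure U) := filtration (HS_generator Ups).

End Enveloping.

Section FilteredIso.
Variables (k A : comPzRingType) (eta : {rmorphism k -> A}).
Variables (R R' : alg_over eta).
Variables (F : nat -> R -> Prop) (F' : nat -> R' -> Prop).

Definition filtered_iso (f : alg_mor R R') : Prop :=
  exists g : alg_mor R' R,
    [/\ cancel f g, cancel g f,
        forall d x, F d x -> F' d (f x) & forall d y, F' d y -> F d (g y)].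

End FilteredIso.

(* Main.v *)
Require Import Defs.
From HB Require Import structures.
From mathcomp Require Import all_boot all_order all_algebra.
From mathcomp Require Import boolp classical_sets functions.
From mathcomp Require Import mpoly.

(* Let E be the Euler derivation, multiplying the coefficient of s^a by |a|.  *)
(* As Q is contained in k, a series r with r_0 = 1 is determined by its       *)
(* logarithmic derivative l = r^-1 E(r), and every l with l_0 = 0 occurs. For *)
(* a Hasse-Schmidt derivation D, the coefficients of D^-1 E(D) are            *)
(* derivations; applying an LR-admissible map to them and solving E(r) = r l  *)
(* gives a series Psi(D), and Psi is an HS-structure. This is checked inside  *)
(* End_k(A) x R, where the pairs (D, Psi(D)) are exactly the series whose     *)
(* logarithmic derivative has its coefficients in the graph L of the          *)
(* LR-admissible map: such series are stable under products because r^-1 L r  *)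
(* is contained in L[[s]], and under substitutions by the chain rule.         *)
(*                                                                            *)
(* Conversely an HS-structure is determined by its values on the Id + delta s,*)
(* by induction on the degree and using the doubling s_i |-> 2 s_i. Hence Psi *)
(* for R = U^LR induces an inverse of kappa, which is filtered because        *)
(* E(r) = r l expresses r_a through the coefficients of lower degree.         *)

Set Implicit Arguments.
Unset Strict Implicit.
Unset Printing Implicit Defensive.

Import GRing.Theory.

Local Open Scope ring_scope.

(** * Truncated power series *)

(** Since positive integers are invertible in A, the equation E(r) = r l, r_0 = 1, gives a bijection
    between the series r with r_0 = 1 and the series l with l_0 = 0 ([euler_eq_exists],
    [euler_eq_unique]). For a bracket-closed left A-submodule L that acts on the image of A by
    commutators, [expL] singles out the r whose l has coefficients in L. The key is that E(r x r^-1)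
    = r [l, x] r^-1, so conjugation by r preserves L[[s]] and the series over A ([conj_ad]), and so
    does conjugation by r^-1 ([conj_flip]). This makes [expL] stable under products ([expLM]) and
    substitutions ([expL_subst]).

    For L = [der_graph] inside End_k(A) x R, each D has a unique lift in [expL] ([HS_log_der],
    [HS_lift], [expL_fst_inj]). Uniqueness turns the stability of [expL] into the axioms of an
    HS-structure for the second projection, [HS_of_LR].

    For uniqueness of HS-structures ([HS_structure_unique]), suppose that two of them agree on the
    Id + d s and in degrees below |a|. The difference of their coefficients at s^a is then additive
    in D, and doubling the variables multiplies it by 2^|a|. Comparing this with the action of
    doubling on the coefficients of D shows that the difference depends on fewer and fewer of them,
    and finally that it vanishes.

    The structure [HS_of_LR] on U^LR induces g : U^HS -> U^LR. The composite g kappa fixes sigma,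
    and kappa g fixes Upsilon by [HS_structure_unique], so both are identities. That g is filtered
    is [LR_filtration_coef]. *)

Section Coefficients.
Variables (M : zmodType) (p : nat) (Delta : coideal p).
Implicit Types (f g : tseries M Delta) (a : 'X_{1..p}).

Lemma tcoef_mkE (F : 'X_{1..p} -> M) a :
  tcoef (mkts F : tseries M Delta) a = if `[< Delta a >] then F a else 0.
Proof. by case: asboolP => Da; [exact: tcoef_mk | exact: tcoef_out]. Qed.

Lemma tcoefB f g a : tcoef (f - g) a = tcoef f a - tcoef g a.
Proof. by apply: (addIr (tcoef g a)); rewrite -tcoefD !subrK. Qed.

Lemma tcoef_sum (I : Type) (s : seq I) (P : pred I) (F : I -> tseries M Delta) a :
  tcoef (\sum_(i <- s | P i) F i) a = \sum_(i <- s | P i) tcoef (F i) a.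
Proof.
apply: (big_morph (fun f : tseries M Delta => tcoef f a)) => [f g|].
  exact: tcoefD.
exact: tcoef0.
Qed.

Lemma tseriesE f g : (forall a, tcoef f a = tcoef g a) -> f = g.
Proof. by move=> fg; apply: tseriesP. Qed.

End Coefficients.

Section Conv.
Variables (p : nat) (V : nmodType).
Implicit Types (a : 'X_{1..p}) (F : 'X_{1..p} -> 'X_{1..p} -> V).

Lemma conv_ind (P : V -> Prop) F a :
    P 0 -> (forall x y, P x -> P y -> P (x + y)) ->
    (forall b c, a = (b + c)%MM -> P (F b c)) -> P (conv F a).
Proof. by move=> P0 PD PF; apply: big_ind => // -[b c] /= /eqP; exact: PF. Qed.

Lemma conv_eq0 F a :
  (forall b c, a = (b + c)%MM -> F b c = 0) -> conv F a = 0.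
Proof. by move=> F0; apply: big1 => -[b c] /= /eqP; exact: F0. Qed.

Lemma conv_ends F a : a != 0%MM ->
  conv F a = F 0%MM a + F a 0%MM
    + conv (fun b c => if (b == 0%MM) || (c == 0%MM) then 0 else F b c) a.
Proof.
move=> an0; have aN := ltnSn (mdeg a).
have N0 : (mdeg (0 : 'X_{1..p})%MM < (mdeg a).+1)%N by rewrite mdeg0.
rewrite /conv (bigD1 (BMultinom N0, BMultinom aN)) /=; last by rewrite add0m.
rewrite (bigD1 (BMultinom aN, BMultinom N0)) /=; last first.
  by rewrite addm0 eqxx xpair_eqE bmeqP /= negb_and an0.
rewrite addrA; congr (_ + _).
rewrite [RHS]big_mkcond [LHS]big_mkcond; apply: eq_bigr => -[b c] _ /=.
rewrite !xpair_eqE !bmeqP /=; move: (bmnm b) (bmnm c) => {}b {}c.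
case: (a =P _) => //= E.
have [b0|nb] := eqVneq b 0%MM; first by rewrite E b0 add0m eqxx.
have [c0|nc] := eqVneq c 0%MM; first by rewrite E c0 addm0 !eqxx andbF.
by rewrite andbF.
Qed.

Lemma mdeg_gt0 a : (0 < mdeg a)%N = (a != 0%MM).
Proof. by rewrite lt0n mdeg_eq0. Qed.

End Conv.

Lemma convMl (R : pzRingType) p (F : 'X_{1..p} -> 'X_{1..p} -> R) x a :
  x * conv F a = conv (fun b c => x * F b c) a.
Proof. exact: mulr_sumr. Qed.

Lemma convMr (R : pzRingType) p (F : 'X_{1..p} -> 'X_{1..p} -> R) x a :
  conv F a * x = conv (fun b c => F b c * x) a.
Proof. exact: mulr_suml. Qed.

Lemma coideal_summandl p (Delta : coideal p) a b c :
  Delta a -> a = (b + c)%MM -> Delta b.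
Proof. by move=> Da E; apply: (@coidealDl _ _ b c); rewrite -E. Qed.

Lemma coideal_summandr p (Delta : coideal p) a b c :
  Delta a -> a = (b + c)%MM -> Delta c.
Proof. by rewrite addmC; exact: coideal_summandl. Qed.

(** * Fixed points of maps that improve agreement by one degree *)

Section Congruence.
Variables (M : zmodType) (p : nat) (Delta : coideal p).
Implicit Types (f g h : tseries M Delta).

Definition eq_below n f g :=
  forall a, (mdeg a < n)%N -> tcoef f a = tcoef g a.

Lemma eq_belowS m n f g : (m <= n)%N -> eq_below n f g -> eq_below m f g.
Proof. by move=> mn fg a am; apply: fg; exact: leq_trans mn. Qed.

Lemma eq_below_eq f g : (forall n, eq_below n f g) -> f = g.
Proof. by move=> fg; apply: tseriesE => a; exact: (fg (mdeg a).+1). Qed.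

Variable T : tseries M Delta -> tseries M Delta.
Hypothesis T_contr : forall n f g, eq_below n f g -> eq_below n.+1 (T f) (T g).

(** The iterates of T from 0 are constant below degree n from the n-th on, so the coefficient at [a]
    can be read off the iterate of rank |a| + 1. *)
Lemma contraction_exists : exists f, T f = f.
Proof.
have itS n m : eq_below n (iter n T 0) (iter (m + n) T 0).
  by elim: n m => [m a //|n IH m]; rewrite addnS /=; exact/T_contr/IH.
pose f : tseries M Delta := mkts (fun a => tcoef (iter (mdeg a).+1 T 0) a).
have fit n : eq_below n f (iter n T 0).
  move=> a an; rewrite tcoef_mkE; case: asboolP => Da; last by rewrite !tcoef_out.
  by rewrite -(subnK an); apply: itS; rewrite ltnSn.
exists f; apply: eq_below_eq => n a an.
rewrite (fit n.+1 a (ltnW an)).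
exact: (T_contr (fit n)) (ltnW an).
Qed.

Lemma contraction_unique f g : T f = f -> T g = g -> f = g.
Proof.
move=> Tf Tg; apply: eq_below_eq; elim=> [a //|n IH].
by rewrite -Tf -Tg; exact: T_contr.
Qed.

End Congruence.

Section Ring.
Variables (R : pzRingType) (p : nat) (Delta : coideal p).
Implicit Types (f g h : tseries R Delta) (a : 'X_{1..p}).

Lemma tcoefM0 f g : tcoef (f * g) 0%MM = tcoef f 0%MM * tcoef g 0%MM.
Proof. by rewrite tcoefM ?conv_at0 //; exact: coideal0. Qed.

Lemma eq_below_mul n f f' g g' :
  eq_below n f f' -> eq_below n g g' -> eq_below n (f * g) (f' * g').
Proof.
move=> ff gg a an; have [Da|Da] := pselect (Delta a); last by rewrite !tcoef_out.
rewrite !tcoefM //; apply: eq_conv => b c E.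
rewrite ff ?gg //; apply: leq_ltn_trans an; rewrite E mdegD.
  exact: leq_addl.
exact: leq_addr.
Qed.

Lemma eq_below_mull n f g g' : tcoef f 0%MM = 0 ->
  eq_below n g g' -> eq_below n.+1 (f * g) (f * g').
Proof.
move=> f0 gg a an; have [Da|Da] := pselect (Delta a); last by rewrite !tcoef_out.
rewrite !tcoefM //; apply: eq_conv => b c E.
have [->|b0] := eqVneq b 0%MM; first by rewrite f0 !mul0r.
rewrite gg // -ltnS; apply: leq_trans an; rewrite ltnS E mdegD.
by rewrite -add1n leq_add2r mdeg_gt0.
Qed.

Lemma eq_below_mulr n f g g' : tcoef f 0%MM = 0 ->
  eq_below n g g' -> eq_below n.+1 (g * f) (g' * f).
Proof.
move=> f0 gg a an; have [Da|Da] := pselect (Delta a); last by rewrite !tcoef_out.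
rewrite !tcoefM //; apply: eq_conv => b c E.
have [->|b0] := eqVneq c 0%MM; first by rewrite f0 !mulr0.
rewrite gg // -ltnS; apply: leq_trans an; rewrite ltnS E mdegD.
by rewrite -addn1 leq_add2l mdeg_gt0.
Qed.

(** A right inverse of h is a fixed point of g |-> 1 + (1 - h) g, a contraction because 1 - h has no
    constant term. The right inverse of f has constant term 1, so it has a right inverse too, which
    must be f. *)
Lemma tseries_inv f : tcoef f 0%MM = 1 ->
  exists2 g, g * f = 1 & f * g = 1.
Proof.
have rinv h : tcoef h 0%MM = 1 -> exists2 g, tcoef g 0%MM = 1 & h * g = 1.
  move=> h0; have c0 : tcoef (1 - h) 0%MM = 0.
    by rewrite tcoefB h0 tcoef1 eqxx subrr.
  have [g gE] := @contraction_exists _ _ _ (fun g => 1 + (1 - h) * g)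
    (fun n g g' gg => fun a an => etrans (tcoefD _ _ _)
       (etrans (congr1 _ (eq_below_mull c0 gg an)) (esym (tcoefD _ _ _)))).
  exists g.
    by rewrite -gE tcoefD tcoefM0 c0 mul0r addr0 tcoef1 eqxx.
  by apply: (addIr (g - h * g)); rewrite addrC subrK -{1}gE mulrBl mul1r.
move=> f0; have [g g0 fg] := rinv _ f0; have [f' _ gf'] := rinv _ g0.
exists g => //; suff -> : f = f' by [].
by rewrite -[f]mulr1 -gf' mulrA fg mul1r.
Qed.

Lemma tcoef_const (x : R) a : tcoef (tconst Delta x) a = if a == 0%MM then x else 0.
Proof.
rewrite tcoef_mkE; case: asboolP => // Da; case: eqP => // E.
by case: Da; rewrite E; exact: coideal0.
Qed.

Lemma tconst_is_zmod_morphism : zmod_morphism (@tconst R p Delta).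
Proof.
by move=> x y; apply: tseriesE => a; rewrite tcoefB !tcoef_const; case: ifP;
   rewrite ?subr0.
Qed.

Lemma tconst_is_monoid_morphism : monoid_morphism (@tconst R p Delta).
Proof.
split=> [|x y]; apply: tseriesE => a.
  by rewrite tcoef_const tcoef1; case: ifP.
by rewrite tcoef_constM !tcoef_const; case: ifP; rewrite ?mulr0.
Qed.

HB.instance Definition _ := GRing.isZmodMorphism.Build R (tseries R Delta)
  (@tconst R p Delta) tconst_is_zmod_morphism.
HB.instance Definition _ := GRing.isMonoidMorphism.Build R (tseries R Delta)
  (@tconst R p Delta) tconst_is_monoid_morphism.

Lemma tconst_conv q (F : 'X_{1..q} -> 'X_{1..q} -> R) (a : 'X_{1..q}) :
  tconst Delta (conv F a) = conv (fun b c => tconst Delta (F b c)) a.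
Proof. exact: rmorph_sum. Qed.

Lemma tcoefMconst f x a : tcoef (f * tconst Delta x) a = tcoef f a * x.
Proof.
have [Da|Da] := pselect (Delta a); last by rewrite !tcoef_out ?mul0r.
rewrite tcoefM // conv0r ?tcoef_const ?eqxx // => b c nc.
by rewrite tcoef_const (negbTE nc) mulr0.
Qed.

(* Since the variables are central, f x g is the sum of the (f x_c g) s^c. *)
Lemma tcoef_mul_mid f x g a : Delta a ->
  tcoef (f * x * g) a =
  conv (fun c d => tcoef (f * tconst Delta (tcoef x c) * g) d) a.
Proof.
move=> Da; rewrite -mulrA tcoefM //.
transitivity (conv (fun b e => conv (fun c d =>
    tcoef f b * tcoef x c * tcoef g d) e) a).
  apply: eq_conv => b e E; rewrite tcoefM; last exact: coideal_summandr Da E.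
  by rewrite convMl; apply: eq_conv => c d _; rewrite mulrA.
rewrite -(convA (fun b c d => tcoef f b * tcoef x c * tcoef g d)).
transitivity (conv (fun b d => conv (fun c1 b1 =>
    tcoef f b1 * tcoef x c1 * tcoef g d) b) a).
  by apply: eq_conv => b d _; rewrite convC.
rewrite (convA (fun c b d => tcoef f b * tcoef x c * tcoef g d)).
apply: eq_conv => c e E; rewrite tcoefM; last exact: coideal_summandr Da E.
by apply: eq_conv => b d _; rewrite tcoefMconst.
Qed.

Section WeightDerivation.
Variable w : 'X_{1..p} -> nat.
Hypothesis wD : forall a b, w (a + b)%MM = (w a + w b)%N.

(** Used with the total degree, which gives the Euler derivation, and with a single exponent, which
    gives s_i d/ds_i. Neither shifts multi-indices, so both act on any truncation. *)
Definition tweight f : tseries R Delta := mkts (fun a => tcoef f a *+ w a).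

Lemma tcoef_weight f a : tcoef (tweight f) a = tcoef f a *+ w a.
Proof. by rewrite tcoef_mkE; case: asboolP => // Da; rewrite tcoef_out ?mul0rn. Qed.

Lemma tweight_is_zmod_morphism : zmod_morphism tweight.
Proof.
by move=> f g; apply: tseriesE => a; rewrite tcoefB !tcoef_weight tcoefB mulrnBl.
Qed.

HB.instance Definition _ := GRing.isZmodMorphism.Build
  (tseries R Delta) (tseries R Delta) tweight tweight_is_zmod_morphism.

Lemma tweightM f g : tweight (f * g) = tweight f * g + f * tweight g.
Proof.
apply: tseriesP => a Da; rewrite tcoefD tcoef_weight !tcoefM // -convD.
rewrite /conv -sumrMnl; apply: eq_bigr => -[b c] /= /eqP E.
rewrite [in w a]E {E}; move: (bmnm b) (bmnm c) => {}b {}c.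
by rewrite !tcoef_weight wD mulrnDr mulrnAl mulrnAr.
Qed.

Lemma weight0 : w 0%MM = 0%N.
Proof. by apply/eqP; rewrite -(eqn_add2l (w 0%MM)) -wD addm0 addn0. Qed.

Lemma tweight_const x : tweight (tconst Delta x) = 0.
Proof.
apply: tseriesE => a; rewrite tcoef_weight tcoef_const tcoef0.
by case: eqP => [->|_]; rewrite ?weight0 ?mulr0n ?mul0rn.
Qed.

End WeightDerivation.

Lemma tweightC w w' f : tweight w (tweight w' f) = tweight w' (tweight w f).
Proof. by apply: tseriesE => a; rewrite !tcoef_weight mulrnAC. Qed.

End Ring.

Notation euler := (tweight (@mdeg _)).

Section Map.
Variables (R S : pzRingType) (u : {rmorphism R -> S}).
Variables (p : nat) (Delta : coideal p).
Implicit Types (f g : tseries R Delta).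

Definition tmap f : tseries S Delta := mkts (fun a => u (tcoef f a)).

Lemma tcoef_map f a : tcoef (tmap f) a = u (tcoef f a).
Proof. by rewrite tcoef_mkE; case: asboolP => // Da; rewrite tcoef_out ?rmorph0. Qed.

Lemma tmap_is_zmod_morphism : zmod_morphism tmap.
Proof.
by move=> f g; apply: tseriesE => a; rewrite tcoefB !tcoef_map tcoefB rmorphB.
Qed.

Lemma tmap_is_monoid_morphism : monoid_morphism tmap.
Proof.
split=> [|f g]; apply: tseriesP => a Da; rewrite tcoef_map.
  by rewrite !tcoef1 rmorph_nat.
rewrite !tcoefM // [LHS]rmorph_sum; apply: eq_bigr => -[b c] _ /=.
by rewrite !tcoef_map rmorphM.
Qed.

HB.instance Definition _ := GRing.isZmodMorphism.Build
  (tseries R Delta) (tseries S Delta) tmap tmap_is_zmod_morphism.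
HB.instance Definition _ := GRing.isMonoidMorphism.Build
  (tseries R Delta) (tseries S Delta) tmap tmap_is_monoid_morphism.

Lemma tmap_const x : tmap (tconst Delta x) = tconst Delta (u x).
Proof.
by apply: tseriesE => a; rewrite tcoef_map !tcoef_const; case: ifP;
   rewrite ?rmorph0.
Qed.

Lemma tmap_weight w f : tmap (tweight w f) = tweight w (tmap f).
Proof.
by apply: tseriesE => a; rewrite tcoef_map !tcoef_weight tcoef_map rmorphMn.
Qed.

End Map.

Lemma tmulC (A : comPzRingType) p (Delta : coideal p) (f g : tseries A Delta) :
  f * g = g * f.
Proof.
apply: tseriesP => a Da; rewrite !tcoefM // [RHS]convC.
by apply: eq_conv => b c _; rewrite mulrC.
Qed.

Program Definition coideal_full p := @Coideal p (fun=> True) _ _.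
Next Obligation. by exists 0%MM. Qed.

Section Truncation.
Variables (p : nat) (Delta Omega : coideal p).
Hypothesis OD : forall a, Omega a -> Delta a.

Definition ttrunc (M : zmodType) (f : tseries M Delta) : tseries M Omega :=
  mkts (tcoef f).

Lemma tcoef_trunc (M : zmodType) (f : tseries M Delta) a :
  Omega a -> tcoef (ttrunc f) a = tcoef f a.
Proof. exact: tcoef_mk. Qed.

Variable R : pzRingType.
Implicit Types f g : tseries R Delta.

Lemma ttruncM f g : ttrunc (f * g) = ttrunc f * ttrunc g.
Proof.
apply: tseriesP => a Oa; rewrite tcoef_trunc // !tcoefM //; last exact: OD.
apply: eq_conv => b c E.
by rewrite !tcoef_trunc //; [exact: coideal_summandr E|exact: coideal_summandl E].
Qed.

Lemma ttrunc_weight w f : ttrunc (tweight w f) = tweight w (ttrunc f).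
Proof.
by apply: tseriesP => a Oa; rewrite tcoef_weight !tcoef_trunc // tcoef_weight.
Qed.

End Truncation.
Arguments ttrunc {p Delta} Omega {M} f.

(** * Infinite sums of series of increasing order *)

Section Summation.
Variables (R : pzRingType) (p q : nat) (Omega : coideal q).
Implicit Types (F G : 'X_{1..p} -> tseries R Omega) (f g : tseries R Omega).

Definition tlow n f := eq_below n f 0.

Lemma tlow_mul m n f g : tlow m f -> tlow n g -> tlow (m + n) (f * g).
Proof.
move=> fm gn a amn; rewrite tcoef0.
have [Da|Da] := pselect (Omega a); last by rewrite tcoef_out.
rewrite tcoefM //; apply: conv_eq0 => b c E.
have [bm|mb] := ltnP (mdeg b) m; first by rewrite fm // tcoef0 mul0r.
rewrite gn ?tcoef0 ?mulr0 // -(ltn_add2l m); apply: leq_ltn_trans amn.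
by rewrite E mdegD leq_add2r.
Qed.

(** The sum over all [a] is then locally finite: a coefficient of degree n only receives terms with
    |a| <= n, which is where [tsum] cuts. *)
Definition summable F := forall a, tlow (mdeg a) (F a).

Definition tsum F : tseries R Omega :=
  mkts (fun e => \sum_(a : 'X_{1..p < (mdeg e).+1}) tcoef (F a) e).

Lemma tsum_below F N : summable F ->
  eq_below N (tsum F) (\sum_(a : 'X_{1..p < N}) F a).
Proof.
move=> sF e eN; have [Oe|Oe] := pselect (Omega e); last by rewrite !tcoef_out.
rewrite tcoef_mk // tcoef_sum.
have F0 (a : 'X_{1..p}) : ~~ (mdeg a <= mdeg e)%N -> tcoef (F a) e = 0.
  by rewrite -ltnNge => ea; rewrite sF // tcoef0.
rewrite -(@big_rmcond _ _ _ _ _ (fun a : 'X_{1..p < _} => mdeg a <= mdeg e)%N)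
  => [|a]; last exact: F0.
rewrite -[RHS](@big_rmcond _ _ _ _ _
  (fun a : 'X_{1..p < _} => mdeg a <= mdeg e)%N) => [|a]; last exact: F0.
apply: (@bsum_widen _ _ _ _ (fun a => mdeg a <= mdeg e)%N
  (fun a => tcoef (F a) e)) => [//|a ae].
exact: leq_ltn_trans ae eN.
Qed.

Lemma eq_tsum F G : F =1 G -> tsum F = tsum G.
Proof. by move=> /funext ->. Qed.

Lemma tsumMl f F : summable F -> f * tsum F = tsum (fun a => f * F a).
Proof.
move=> sF; apply: eq_below_eq => N.
have sfF : summable (fun a => f * F a).
  by move=> a; rewrite -[mdeg a]add0n; apply: tlow_mul.
move=> e eN; rewrite (tsum_below sfF eN) -mulr_sumr.
by apply: eq_below_mul eN => //; exact: tsum_below.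
Qed.

Lemma tsumMr f F : summable F -> tsum F * f = tsum (fun a => F a * f).
Proof.
move=> sF; apply: eq_below_eq => N.
have sfF : summable (fun a => F a * f).
  by move=> a; rewrite -[mdeg a]addn0; apply: tlow_mul.
move=> e eN; rewrite (tsum_below sfF eN) -mulr_suml.
by apply: eq_below_mul eN => //; exact: tsum_below.
Qed.

Lemma tsum_euler F : euler (tsum F) = tsum (fun a => euler (F a)).
Proof.
apply: tseriesP => e Oe; rewrite tcoef_weight !tcoef_mk // -sumrMnl.
by apply: eq_bigr => a _; rewrite tcoef_weight.
Qed.

Lemma tsum_sum (I : finType) (F : I -> 'X_{1..p} -> tseries R Omega) :
  tsum (fun a => \sum_i F i a) = \sum_i tsum (F i).
Proof.
apply: tseriesP => e Oe; rewrite tcoef_sum tcoef_mk //.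
under eq_bigr do rewrite tcoef_sum.
by rewrite exchange_big; apply: eq_bigr => i _; rewrite tcoef_mk.
Qed.

(** Both sides sum F b c over all pairs. Below degree N the finite ranges |b + c| < N and |b|, |c| <
    N give the same result, as the pairs in which they differ have order at least N. *)
Lemma tsum_conv (F : 'X_{1..p} -> 'X_{1..p} -> tseries R Omega) :
    (forall b c, tlow (mdeg b + mdeg c) (F b c)) ->
  tsum (conv F) = tsum (fun b => tsum (F b)).
Proof.
move=> lF.
have s1 b : summable (F b).
  by move=> c; apply: eq_belowS (lF b c); exact: leq_addl.
have s2 : summable (fun b => tsum (F b)).
  move=> b e eb; rewrite (tsum_below (s1 b) (ltnSn (mdeg e))) tcoef0 tcoef_sum.
  rewrite big1 // => c _; rewrite (lF b c) ?tcoef0 //.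
  exact: leq_trans eb (leq_addr _ _).
have s3 : summable (conv F).
  move=> a e ea; rewrite tcoef0 /conv tcoef_sum big1 // => -[b c] /= /eqP E.
  by rewrite (lF b c) ?tcoef0 // -mdegD -E.
apply: eq_below_eq => N e eN; rewrite (tsum_below s3 eN) (tsum_below s2 eN).
rewrite !tcoef_sum.
transitivity (\sum_(b : 'X_{1..p < N}) \sum_(c : 'X_{1..p < N}) tcoef (F b c) e);
  last first.
  by apply: eq_bigr => b _; rewrite (tsum_below (s1 b) eN) tcoef_sum.
transitivity (\sum_(a : 'X_{1..p < N}) \sum_(b : 'X_{1..p < N})
   \sum_(c : 'X_{1..p < N} | a == (b + c)%MM :> 'X_{1..p}) tcoef (F b c) e).
  apply: eq_bigr => a _; rewrite (conv_bound _ (bmdeg a)) tcoef_sum.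
  by apply: eq_bigr => b _; rewrite tcoef_sum.
rewrite exchange_big; apply: eq_bigr => b _ /=.
under eq_bigr do rewrite big_mkcond.
rewrite exchange_big; apply: eq_bigr => c _ /=; rewrite -big_mkcond.
have [bN|Nb] := ltnP (mdeg (b + c)%MM) N.
  by rewrite (big_pred1 (BMultinom bN)).
rewrite big_pred0 => [|a]; last first.
  by apply: contraTF Nb => /eqP <-; rewrite -ltnNge bmdeg.
by rewrite (lF b c) ?tcoef0 // -mdegD; exact: leq_trans Nb.
Qed.

End Summation.

(** * Series with logarithmic derivative in a Lie algebra *)

Section LieSeries.
Variables (A : comPzRingType) (R : pzRingType) (iota : {rmorphism A -> R}).
Hypothesis divA : forall n, exists x : A, x * n.+1%:R = 1.

Lemma iota_div n : (0 < n)%N -> exists x, iota x * n%:R = 1.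
Proof.
case: n => // n _; have [x xn] := divA n; exists x.
by rewrite -(rmorph_nat iota) -rmorphM xn rmorph1.
Qed.

Lemma mulrn_inj_div n (x y : R) : (0 < n)%N -> x *+ n = y *+ n -> x = y.
Proof.
move=> /iota_div[c cn] E; rewrite -[x]mul1r -[y]mul1r -cn -!mulrA.
by rewrite !mulr_natl E.
Qed.

Definition left_submod (N : R -> Prop) :=
  [/\ N 0, forall x y, N x -> N y -> N (x + y) & forall a x, N x -> N (iota a * x)].

Definition tin (N : R -> Prop) p (Delta : coideal p) (f : tseries R Delta) :=
  forall a, N (tcoef f a).

Definition base x := exists a, x = iota a.

Lemma left_submod_base : left_submod base.
Proof.
split=> [|_ _ [a ->] [b ->]|a _ [b ->]]; first by exists 0; rewrite rmorph0.
  by exists (a + b); rewrite rmorphD.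
by exists (a * b); rewrite rmorphM.
Qed.

Section Submodule.
Variable N : R -> Prop.
Hypothesis NN : left_submod N.

Lemma left_submod0 : N 0. Proof. by case: NN. Qed.

Lemma left_submodD x y : N x -> N y -> N (x + y).
Proof. by case: NN => _ + _; exact. Qed.

Lemma left_submodM a x : N x -> N (iota a * x).
Proof. by case: NN => _ _; exact. Qed.

Lemma left_submodN x : N x -> N (- x).
Proof. by move=> Nx; rewrite -mulN1r -(rmorphN1 iota); exact: left_submodM. Qed.

Lemma left_submodMn x n : N x -> N (x *+ n).
Proof. by move=> Nx; rewrite -mulr_natl -(rmorph_nat iota); exact: left_submodM. Qed.

Lemma left_submod_div n x : (0 < n)%N -> N (x *+ n) -> N x.
Proof.
move=> /iota_div[c cn] Nx; rewrite -[x]mul1r -cn -mulrA mulr_natl.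
exact: left_submodM.
Qed.

Lemma left_submod_conv p (F : 'X_{1..p} -> 'X_{1..p} -> R) a :
  (forall b c, a = (b + c)%MM -> N (F b c)) -> N (conv F a).
Proof. exact: (conv_ind left_submod0 left_submodD). Qed.

Lemma tin_tsum p q (Omega : coideal q) (F : 'X_{1..p} -> tseries R Omega) :
  (forall a, tin N (F a)) -> tin N (tsum F).
Proof.
move=> NF e; rewrite tcoef_mkE; case: asboolP => _; last exact: left_submod0.
by apply: big_ind => [||a _]; [exact: left_submod0|exact: left_submodD|exact: NF].
Qed.

Lemma tin_mul_mid p (Delta : coideal p) (f g y : tseries R Delta) :
    (forall x, N x -> tin N (f * tconst Delta x * g)) ->
  tin N y -> tin N (f * y * g).
Proof.
move=> Nfg Ny a; have [Da|Da] := pselect (Delta a); last first.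
  by rewrite tcoef_out //; exact: left_submod0.
by rewrite tcoef_mul_mid //; apply: left_submod_conv => b c _; exact/Nfg/Ny.
Qed.

End Submodule.

(** * The differential equation E(r) = r l *)

Section Equation.
Variables (p : nat) (Delta : coideal p).
Implicit Types (r w l f g : tseries R Delta).

Lemma euler_eq_const0 r l : tcoef r 0%MM = 1 -> euler r = r * l ->
  tcoef l 0%MM = 0.
Proof.
move=> r0 /(congr1 (fun f => tcoef f 0%MM)).
by rewrite tcoef_weight mdeg0 tcoefM0 r0 mul1r.
Qed.

(** Divides the coefficient of s^a by |a|, hence a section of E on series without constant term;
    [xget] picks an element of A that serves as 1/|a|. *)
Definition integ f : tseries R Delta :=
  mkts (fun a => iota (xget 0 [set x | iota x * (mdeg a)%:R = 1]) * tcoef f a).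

Lemma integ_coef f a : a != 0%MM -> tcoef (integ f) a *+ mdeg a = tcoef f a.
Proof.
move=> a0; rewrite tcoef_mkE; case: asboolP => Da; last first.
  by rewrite mul0rn tcoef_out.
rewrite -mulrnAr -[tcoef f a *+ _]mulr_natl mulrA.
case: xgetP => [x _ /= ->|]; first by rewrite mul1r.
have [|x xE] := @iota_div (mdeg a); first by rewrite mdeg_gt0.
by move/(_ x); case.
Qed.

Lemma euler_inj f g : tcoef f 0%MM = tcoef g 0%MM -> euler f = euler g -> f = g.
Proof.
move=> fg0 fg; apply: tseriesE => a; have [->//|a0] := eqVneq a 0%MM.
apply: (@mulrn_inj_div (mdeg a)); first by rewrite mdeg_gt0.
by rewrite -!tcoef_weight fg.
Qed.

Lemma euler_integ f : tcoef f 0%MM = 0 -> euler (integ f) = f.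
Proof.
move=> f0; apply: tseriesE => a; rewrite tcoef_weight.
by have [->|a0] := eqVneq a 0%MM; [rewrite mdeg0 f0 | rewrite integ_coef].
Qed.

Section Fix.
Variables (c : R) (l : tseries R Delta).
Hypothesis l0 : tcoef l 0%MM = 0.

(** Integral form of E(r) = r l with r_0 = c. As l_0 = 0, a coefficient of f l only involves
    coefficients of f of lower degree, so T is a contraction. *)
Let T f := tconst Delta c + integ (f * l - tconst Delta (tcoef (f * l) 0%MM)).

Let T0 f : tcoef (T f) 0%MM = c.
Proof.
rewrite tcoefD tcoef_const eqxx tcoef_mkE asboolT ?tcoefB ?tcoef_const ?eqxx.
  by rewrite subrr mulr0 addr0.
exact: coideal0.
Qed.

Let eulerT f : euler (T f) = f * l.
Proof.
have fl0 : tcoef (f * l) 0%MM = 0 by rewrite tcoefM0 l0 mulr0.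
rewrite raddfD /= tweight_const ?add0r; last exact: mdegD.
by rewrite fl0 rmorph0 subr0 euler_integ.
Qed.

Let T_contr n f g : eq_below n f g -> eq_below n.+1 (T f) (T g).
Proof.
move=> fg a an; have [->|a0] := eqVneq a 0%MM; first by rewrite !T0.
apply: (@mulrn_inj_div (mdeg a)); first by rewrite mdeg_gt0.
by rewrite -!tcoef_weight !eulerT; exact: eq_below_mulr an.
Qed.

Lemma euler_eq_exists : exists2 r, tcoef r 0%MM = c & euler r = r * l.
Proof.
have [r rE] := contraction_exists T_contr.
by exists r; rewrite -{1}rE ?T0 ?eulerT.
Qed.

Lemma euler_eq_unique r r' : tcoef r 0%MM = c -> tcoef r' 0%MM = c ->
  euler r = r * l -> euler r' = r' * l -> r = r'.
Proof.
move=> r0 r0' Er Er'; apply: (contraction_unique T_contr).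
  by apply: euler_inj; rewrite ?T0 ?eulerT.
by apply: euler_inj; rewrite ?T0 ?eulerT.
Qed.

End Fix.

(** Expand E(w r) w = E(1) w = 0. *)
Lemma euler_inverse r w l : euler r = r * l -> w * r = 1 -> r * w = 1 ->
  euler w = - l * w.
Proof.
move=> Er wr rw; apply: (addrI (w * r * l * w)).
rewrite mulNr wr mul1r subrr -[l]mul1r -wr -(mulrA w r l) -Er.
rewrite -[X in _ + X]mulr1 -rw mulrA -mulrDl addrC -tweightM; last exact: mdegD.
by rewrite wr -(rmorph1 (tconst Delta)) tweight_const ?mul0r //; exact: mdegD.
Qed.

(* With y = r x w, expand x = w y r = w x r + (terms with y_c, c <> 0). *)
Lemma conj_flip (N : R -> Prop) r w : left_submod N ->
    tcoef r 0%MM = 1 -> w * r = 1 -> r * w = 1 ->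
    (forall x, N x -> tin N (r * tconst Delta x * w)) ->
  forall x, N x -> tin N (w * tconst Delta x * r).
Proof.
move=> NN r0 wr rw Nrw.
have w0 : tcoef w 0%MM = 1.
  move/(congr1 (fun f => tcoef f 0%MM)): wr.
  by rewrite tcoefM0 r0 mulr1 tcoef1 eqxx.
suff H n x a : (mdeg a < n)%N -> N x -> N (tcoef (w * tconst Delta x * r) a).
  by move=> x Nx a; exact: H (ltnSn _) Nx.
elim: n x a => // n IH x a; rewrite ltnS => an Nx.
have [Da|Da] := pselect (Delta a); last by rewrite tcoef_out //; case: NN.
have [->|a0] := eqVneq a 0%MM.
  by rewrite !tcoefM0 w0 r0 mulr1 mul1r tcoef_const eqxx.
pose y := r * tconst Delta x * w.
have y0 : tcoef y 0%MM = x.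
  by rewrite !tcoefM0 w0 r0 mulr1 mul1r tcoef_const eqxx.
have : tcoef (w * y * r) a = 0.
  by rewrite /y !mulrA wr mul1r -mulrA wr mulr1 tcoef_const (negbTE a0).
rewrite tcoef_mul_mid // conv_ends // y0 -addrA => /eqP.
rewrite addr_eq0 => /eqP ->; apply: (left_submodN NN); apply: (left_submodD NN).
  by rewrite !tcoefM0 w0 r0 mulr1 mul1r tcoef_const eqxx; exact: Nrw.
apply: (left_submod_conv NN) => b c E.
case: ifPn => [_|]; first by case: NN.
rewrite negb_or => /andP[b0 c0]; apply: IH; last exact: Nrw.
apply: leq_trans an; rewrite E mdegD -{1}[mdeg c]add0n ltn_add2r.
by rewrite mdeg_gt0.
Qed.

End Equation.

Variable L : R -> Prop.
Hypothesis LL : left_submod L.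
Hypothesis L_bracket : forall x y, L x -> L y -> L (x * y - y * x).
Hypothesis L_base : forall x y, L x -> base y -> base (x * y - y * x).

(** Plays the part of the group exp(L[[s]]), described by the left logarithmic derivative r^-1
    E(r). *)
Definition expL p (Delta : coideal p) (r : tseries R Delta) :=
  tcoef r 0%MM = 1 /\ exists2 l, tin L l & euler r = r * l.

Section Conjugation.
Variables (p : nat) (Delta : coideal p) (r w : tseries R Delta).
Hypotheses (rL : expL r) (wr : w * r = 1) (rw : r * w = 1).

(** E(r x w) = r [l, x] w and l_0 = 0, so |a| times the coefficient at [a] is a sum of coefficients
    of lower degree of conjugates of the [l_b, x], which lie in N again. Induct on the degree and
    divide by |a|. *)
Lemma conj_ad (N : R -> Prop) : left_submod N ->
    (forall x y, L x -> N y -> N (x * y - y * x)) ->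
  forall x, N x -> tin N (r * tconst Delta x * w).
Proof.
move=> NN LN; have [r0 [l Ll Er]] := rL.
have l0 := euler_eq_const0 r0 Er; have Ew := euler_inverse Er wr rw.
have w0 : tcoef w 0%MM = 1.
  move/(congr1 (fun f => tcoef f 0%MM)): wr.
  by rewrite tcoefM0 r0 mulr1 tcoef1 eqxx.
suff H n x a : (mdeg a < n)%N -> N x -> N (tcoef (r * tconst Delta x * w) a).
  by move=> x Nx a; exact: H (ltnSn _) Nx.
elim: n x a => // n IH x a; rewrite ltnS => an Nx.
have [Da|Da] := pselect (Delta a); last by rewrite tcoef_out //; case: NN.
have [->|a0] := eqVneq a 0%MM.
  by rewrite !tcoefM0 w0 r0 mulr1 mul1r tcoef_const eqxx.
apply: (@left_submod_div N NN (mdeg a)); first by rewrite mdeg_gt0.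
rewrite -tcoef_weight !tweightM; try exact: mdegD.
rewrite tweight_const ?mulr0 ?addr0; last exact: mdegD.
have -> : euler r * tconst Delta x * w + r * tconst Delta x * euler w =
    r * (l * tconst Delta x - tconst Delta x * l) * w.
  by rewrite Er Ew mulrBr mulrBl mulNr mulrN !mulrA.
rewrite tcoef_mul_mid //; apply: (left_submod_conv NN) => b c E.
rewrite tcoefB tcoefMconst tcoef_constM.
have [->|b0] := eqVneq b 0%MM.
  by rewrite l0 mul0r mulr0 subrr rmorph0 mulr0 mul0r tcoef0; case: NN.
apply: IH; last exact: LN.
apply: leq_trans an; rewrite E mdegD -{1}[mdeg c]add0n ltn_add2r.
by rewrite mdeg_gt0.
Qed.

Lemma conj_base a : tin base (r * tconst Delta (iota a) * w).
Proof. by apply: (conj_ad left_submod_base L_base); exists a. Qed.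

Lemma conj_inv_L x : L x -> tin L (w * tconst Delta x * r).
Proof.
by case: rL => r0 _; apply: conj_flip => //; exact: conj_ad.
Qed.

End Conjugation.

(** E(r r') = r l r' + r r' l' = r r' (r'^-1 l r' + l'), and r'^-1 L r' stays in L[[s]]. *)
Lemma expLM p (Delta : coideal p) (r r' : tseries R Delta) :
  expL r -> expL r' -> expL (r * r').
Proof.
move=> [r0 [l Ll Er]] rL'; have [r0' [l' Ll' Er']] := rL'.
split; first by rewrite tcoefM0 r0 r0' mulr1.
have [w wr rw] := tseries_inv r0'.
exists (w * l * r' + l').
  move=> a; rewrite tcoefD; apply: (left_submodD LL) => //.
  by apply: (tin_mul_mid LL) => // x Lx; exact: conj_inv_L.
rewrite tweightM ?Er ?Er'; last exact: mdegD.
by rewrite mulrDr !mulrA -[r * r' * w]mulrA rw mulr1.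
Qed.

(** * Stability under substitutions, where [c a] stands for phi(s^a) *)

Section Substitution.
Variables (p q : nat) (Omega : coideal q) (c : 'X_{1..p} -> tseries A Omega).
Hypothesis c0 : c 0%MM = 1.
Hypothesis cD : forall a b, c (a + b)%MM = c a * c b.
Hypothesis c_low : summable c.

(* The contribution of the i-th variable to the chain rule, see euler_c. *)
Let W (i : 'I_p) (a : 'X_{1..p}) : tseries A Omega :=
  if a i == 0%N then 0 else c (a - U_(i))%MM * euler (c U_(i)%MM).

Let W_low i : summable (W i).
Proof.
move=> a; rewrite /W; case: eqP => [_|/eqP ai]; first by move=> e _.
have -> : mdeg a = (mdeg (a - U_(i))%MM + 1)%N.
  by rewrite -[1%N](mdeg1 i) -mdegD submK // lep1mP.
apply: tlow_mul; first exact: c_low.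
move=> e e1; rewrite tcoef_weight c_low ?mdeg1 //.
by rewrite tcoef0 mul0rn.
Qed.

Let WD (i : 'I_p) (a b : 'X_{1..p}) : a i != 0%N -> W i (b + a)%MM = c b * W i a.
Proof.
move=> ai; rewrite /W mnmDE addn_eq0 (negbTE ai) andbF mulrA -cD.
by congr (c _ * _); apply/mnmP => j; rewrite !(mnmDE, mnmBE) addnBA // mnm1E;
   case: eqP => // <-; rewrite lt0n.
Qed.

(** Leibniz rule on c a = c (a - e_j) c e_j: the factor c e_j is absorbed into the terms of a - e_j
    by [WD], and the other summand is one more copy of W j a. *)
Let euler_c (a : 'X_{1..p}) : euler (c a) = \sum_i W i a *+ a i.
Proof.
move: {-1}(mdeg a) (erefl (mdeg a)) => n; elim: n a => [|n IH] a an.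
  have -> : a = 0%MM by apply/eqP; rewrite -mdeg_eq0 an.
  rewrite c0 -(rmorph1 (tconst Omega)) tweight_const; last exact: mdegD.
  by rewrite big1 // => i _; rewrite mnm0E.
have [j aj] : exists j, a j != 0%N.
  apply: contrapT => na; suff a0 : a = 0%MM by rewrite a0 mdeg0 in an.
  by apply/mnmP => j; rewrite mnm0E; apply/eqP/negPn/negP => aj; apply: na; exists j.
have Ea : a = ((a - U_(j)) + U_(j))%MM by rewrite submK // lep1mP.
set b := (a - U_(j))%MM in Ea.
have bn : mdeg b = n.
  by apply/eqP; rewrite -eqSS -an [in X in _ == X]Ea mdegD mdeg1 addn1.
rewrite Ea cD tweightM ?(IH b) //; last exact: mdegD.
transitivity (\sum_i (W i (b + U_(j))%MM *+ b i + W i (b + U_(j))%MM *+ (j == i))).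
  rewrite big_split /=; congr (_ + _).
    rewrite mulr_suml; apply: eq_bigr => i _; have [->|bi] := eqVneq (b i) 0%N.
      by rewrite !mulr0n mul0r.
    by rewrite addmC WD // mulrnAl tmulC.
  rewrite (bigD1 j) //= eqxx big1 ?addr0 => [|i /negbTE]; last first.
    by rewrite eq_sym => ->.
  rewrite /W mnmDE mnm1E eqxx addn1 /= mulr1n; congr (c _ * _).
  by apply/mnmP => i; rewrite mnmBE mnmDE addnK.
by apply: eq_bigr => i _; rewrite mnmDE mnm1E mulrnDr.
Qed.

Let C (a : 'X_{1..p}) : tseries R Omega := tmap iota (c a).
Let WR (i : 'I_p) (a : 'X_{1..p}) : tseries R Omega := tmap iota (W i a).

Let tlow_map n (f : tseries A Omega) (x : tseries R Omega) :
  tlow n f -> tlow n (tmap iota f * x).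
Proof.
move=> fn; rewrite -[n]addn0; apply: tlow_mul => // e en.
by rewrite tcoef_map fn // !tcoef0 rmorph0.
Qed.

Let map_comm (f g : tseries A Omega) :
  tmap iota f * tmap iota g = tmap iota g * tmap iota f.
Proof. by rewrite -!rmorphM tmulC. Qed.

Definition tsubst (r : tseries R (coideal_full p)) : tseries R Omega :=
  tsum (fun a => C a * tconst Omega (tcoef r a)).

Let tsubst_summable (r : tseries R (coideal_full p)) :
  summable (fun a => C a * tconst Omega (tcoef r a)).
Proof. by move=> a; exact/tlow_map/c_low. Qed.

Let tsubst0 (r : tseries R (coideal_full p)) :
  tcoef (tsubst r) 0%MM = tcoef r 0%MM.
Proof.
have N0 : (mdeg (0 : 'X_{1..q})%MM < 1)%N by rewrite mdeg0.
rewrite (tsum_below (tsubst_summable r) N0) tcoef_sum (bigD1 bm0) //= big1.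
  by rewrite addr0 /C c0 rmorph1 mul1r tcoef_const eqxx.
move=> a; rewrite bmeqP /= -mdeg_eq0 -leqn0 -ltnS => /negP [].
exact: bmdeg.
Qed.

Section Element.
Variables (r w : tseries R (coideal_full p)) (z' : tseries R Omega).
Hypotheses (rL : expL r) (wr : w * r = 1) (rw : r * w = 1).
Let z := tsubst r.
Hypotheses (z'z : z' * z = 1) (zz' : z * z' = 1).

(** Substitution need not be multiplicative over R, as A is not central. It respects the product in
    r a = y r, because y = r a r^-1 has coefficients in A, which commute with the phi(s^b). Hence z
    a z^-1 is the substitute of y. *)
Let conj_base_subst x : base x -> tin base (z * tconst Omega x * z').
Proof.
case=> a ->; pose y := r * tconst (coideal_full p) (iota a) * w.
have [yA yE] : {yA : 'X_{1..p} -> A & forall b, tcoef y b = iota (yA b)}.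
  apply: (@boolp.choice _ _ (fun b x => tcoef y b = iota x)).
  exact: conj_base.
have ry : r * tconst (coideal_full p) (iota a) = y * r.
  by rewrite /y -[RHS]mulrA wr mulr1.
suff -> : z * tconst Omega (iota a) = tsum (fun b => C b * tconst Omega (tcoef y b)) * z.
  rewrite -mulrA zz' mulr1; apply: (tin_tsum left_submod_base) => b e.
  rewrite tcoefMconst tcoef_map yE.
  by exists (tcoef (c b) e * yA b); rewrite rmorphM.
rewrite tsumMr // tsumMr; last exact: tsubst_summable.
transitivity (tsum (conv (fun b d =>
    C (b + d)%MM * tconst Omega (tcoef y b) * tconst Omega (tcoef r d)))).
  apply: eq_tsum => b; rewrite -mulrA -rmorphM -tcoefMconst ry tcoefM //.
  rewrite /= tconst_conv convMl; apply: eq_conv => d e ->.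
  by rewrite -mulrA; congr (_ * _); exact: rmorphM.
rewrite tsum_conv => [|b d]; last first.
  by rewrite -mulrA -mdegD; exact/tlow_map/c_low.
apply: eq_tsum => b; rewrite tsumMl //; apply: eq_tsum => d.
rewrite /C cD rmorphM yE -[tconst Omega (iota _)]tmap_const.
by rewrite !mulrA; congr (_ * _); rewrite -!mulrA map_comm.
Qed.

Let conj_base_subst_inv (f : tseries A Omega) :
  tin base (z' * tmap iota f * z).
Proof.
apply: (tin_mul_mid left_submod_base) => [x|a]; last first.
  by rewrite tcoef_map; exists (tcoef f a).
apply: (conj_flip left_submod_base _ z'z zz' conj_base_subst).
by rewrite tsubst0; case: rL.
Qed.

(** The partial logarithmic derivative r^-1 s_i dr/ds_i; by [eps0] it only involves monomials
    divisible by s_i. *)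
Let eps (i : 'I_p) := w * tweight (fun a : 'X_{1..p} => a i) r.

Let eps0 (i : 'I_p) (a : 'X_{1..p}) : a i = 0%N -> tcoef (eps i) a = 0.
Proof.
move=> ai; rewrite tcoefM //; apply: conv_eq0 => b d E.
rewrite tcoef_weight (_ : d i = 0%N) ?mulr0 //.
by apply/eqP; move/eqP: ai; rewrite E mnmDE addn_eq0 => /andP[].
Qed.

(** As E and s_i d/ds_i commute, E(eps_i) = [eps_i, l] + s_i dl/ds_i. Since l_0 = 0, the bracket
    only involves coefficients of eps_i of lower degree. *)
Let eps_L i : tin L (eps i).
Proof.
have [r0 [l Ll Er]] := rL; have l0 := euler_eq_const0 r0 Er.
have Ew := euler_inverse Er wr rw.
have Ee : euler (eps i) = eps i * l - l * eps i + tweight (fun a : 'X_{1..p} => a i) l.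
  have wD (a b : 'X_{1..p}) : (a + b)%MM i = (a i + b i)%N by rewrite mnmDE.
  rewrite tweightM ?Ew; last exact: mdegD.
  rewrite tweightC Er tweightM // mulrDr !mulrA wr mul1r mulNr mulNr.
  by rewrite addrA [X in X + _]addrC.
suff H n a : (mdeg a < n)%N -> L (tcoef (eps i) a) by move=> a; exact: H (ltnSn _).
elim: n a => // n IH a; rewrite ltnS => an.
have [->|a0] := eqVneq a 0%MM; first by rewrite eps0 ?mnm0E //; case: LL.
apply: (left_submod_div LL (n := mdeg a)); first by rewrite mdeg_gt0.
rewrite -tcoef_weight Ee tcoefD tcoefB !tcoefM // [X in _ - X + _]convC.
rewrite tcoef_weight; apply: (left_submodD LL); last exact: (left_submodMn LL).
rewrite /conv -sumrB.
apply: (left_submod_conv LL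
  (F := fun b d => tcoef (eps i) b * tcoef l d - tcoef l d * tcoef (eps i) b)).
move=> b d E; have [->|d0] := eqVneq d 0%MM.
  by rewrite l0 mulr0 mul0r subrr; case: LL.
apply: L_bracket => //; apply: IH; apply: leq_trans an.
by rewrite E mdegD -[X in (X < _)%N]addn0 ltn_add2l mdeg_gt0.
Qed.

Let weight_r i : tweight (fun a : 'X_{1..p} => a i) r = r * eps i.
Proof. by rewrite mulrA rw mul1r. Qed.

(** By [euler_c], E(z) is the sum of the W i a (a_i r_a), and a_i r_a is the coefficient of r eps_i
    at [a]. A multi-index d that occurs in eps_i has d_i <> 0, so W i (b + d) = c b W i d, and
    summing over b reassembles z. *)
Let euler_tsubst : euler z =
  z * \sum_i tsum (fun a => z' * WR i a * z * tconst Omega (tcoef (eps i) a)).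
Proof.
rewrite mulr_sumr /z tsum_euler.
transitivity (tsum (fun a => \sum_i WR i a * tconst Omega (tcoef r a *+ a i))).
  apply: eq_tsum => a; rewrite tweightM; last exact: mdegD.
  rewrite tweight_const ?mulr0 ?addr0; last exact: mdegD.
  rewrite -tmap_weight euler_c rmorph_sum mulr_suml; apply: eq_bigr => i _.
  by rewrite !raddfMn mulrnAl mulrnAr.
rewrite tsum_sum; apply: eq_bigr => i _.
transitivity (tsum (conv (fun d b => WR i d * C b *
    tconst Omega (tcoef r b) * tconst Omega (tcoef (eps i) d)))).
  apply: eq_tsum => a; rewrite -(tcoef_weight (fun a : 'X_{1..p} => a i)) weight_r tcoefM // convC.
  rewrite tconst_conv convMl; apply: eq_conv => d b ->.
  have [di|di] := eqVneq (d i) 0%N.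
    by rewrite eps0 // mulr0 rmorph0 !mulr0.
  by rewrite addmC /WR WD // rmorphM rmorphM map_comm !mulrA.
rewrite tsum_conv => [|d b]; last first.
  rewrite -!mulrA; apply: tlow_mul; last exact/tlow_map/c_low.
  by rewrite -[WR i d]mulr1; exact/tlow_map/W_low.
have sW : summable (fun a => z' * WR i a * z * tconst Omega (tcoef (eps i) a)).
  move=> a; rewrite -!mulrA -[mdeg a]add0n; apply: tlow_mul => //.
  exact/tlow_map/W_low.
rewrite tsumMl //; apply: eq_tsum => d.
rewrite !mulrA zz' mul1r /z /tsubst tsumMl // tsumMr => [|a].
  by apply: eq_tsum => b; rewrite !mulrA.
by rewrite -[mdeg a]add0n; apply: tlow_mul => //; exact: tsubst_summable.
Qed.

Lemma expL_tsubst_aux : expL z.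
Proof.
split; first by rewrite tsubst0; case: rL.
eexists; last exact: euler_tsubst.
move=> e; rewrite tcoef_sum; apply: big_ind => [||i _].
- by case: LL.
- exact: left_submodD.
apply: (tin_tsum LL) => a e'; rewrite tcoefMconst.
(* The conjugate of W i a has coefficients in A, and these multiply the coefficients of eps_i, which
   lie in L, on the left. *)
have [x ->] := conj_base_subst_inv (W i a) e'.
by apply: (left_submodM LL); exact: eps_L.
Qed.

End Element.

Lemma expL_tsubst r : expL r -> expL (tsubst r).
Proof.
move=> rL; have [r0 _] := rL; have [w wr rw] := tseries_inv r0.
have z0 : tcoef (tsubst r) 0%MM = 1 by rewrite tsubst0.
have [z' z'z zz'] := tseries_inv z0.
exact: (@expL_tsubst_aux r w z').
Qed.

End Substitution.

(** Extend l by zero and solve E(s) = s l again; uniqueness over Delta identifies the truncation of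
    s. The chain rule can thus be applied to untruncated series: its terms phi(s^(a - e_i))
    E(phi(s_i)) need not vanish for [a] outside Delta. *)
Lemma expL_extend p (Delta : coideal p) (r : tseries R Delta) : expL r ->
  exists2 s : tseries R (coideal_full p), expL s & ttrunc Delta s = r.
Proof.
move=> [r0 [l Ll Er]]; have l0 := euler_eq_const0 r0 Er.
pose l' : tseries R (coideal_full p) := mkts (tcoef l).
have l'0 : tcoef l' 0%MM = 0 by rewrite tcoef_mk.
have [s s0 Es] := euler_eq_exists 1 l'0.
exists s; first by split=> //; exists l' => // a; rewrite tcoef_mk.
apply: (euler_eq_unique l0 _ r0 _ Er).
  by rewrite tcoef_trunc //; exact: coideal0.
rewrite -(_ : ttrunc Delta l' = l); last first.
  by apply: tseriesP => a Da; rewrite tcoef_trunc // tcoef_mk.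
by rewrite -ttruncM // -Es ttrunc_weight.
Qed.

Lemma expL_subst p q (Delta : coideal p) (Omega : coideal q)
    (phi : substmap A Delta Omega) (r : tseries R Delta) :
  expL r -> expL (subst_act phi iota r).
Proof.
move=> /expL_extend[s sL <-].
have -> : subst_act phi iota (ttrunc Delta s) =
    tsubst (fun a => phi (tmonom A Delta a)) s.
  apply: tseriesP => e Oe; rewrite !tcoef_mk //; apply: eq_bigr => a _.
  rewrite tcoefMconst tcoef_map; have [Da|Da] := pselect (Delta a).
    by rewrite tcoef_trunc.
  by rewrite tmonom_out // rmorph0 tcoef0 rmorph0 !mul0r.
apply: expL_tsubst => //.
- by rewrite tmonom0 rmorph1.
- by move=> a b; rewrite tmonomD rmorphM.
- by move=> a e ea; rewrite subst_monom_low // tcoef0.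
Qed.

End LieSeries.

(** * The HS-structure of an LR-admissible map *)

Section HSOperators.
Variables (k A : comPzRingType) (eta : {rmorphism k -> A}).
Variables (p : nat) (Delta : coideal p).
Implicit Types D : HS eta Delta.

Lemma HS_inj D D' : HS_series D = HS_series D' -> D = D'.
Proof.
case: D D' => [f f0 fM] [g g0 gM] /= fg; rewrite fg in f0 fM *.
by congr HSder; exact: Prop_irrelevance.
Qed.

Lemma conv_kendE (F : 'X_{1..p} -> 'X_{1..p} -> kend eta) a x :
  conv F a x = conv (fun b c => F b c x) a.
Proof. exact: kend_sumE. Qed.

Lemma HS_kendC D x :
  HS_series D * tconst Delta (kendC eta x) =
  mkts (fun a => kendC eta (tcoef D a x)) * HS_series D.
Proof.
apply: tseriesP => a Da; rewrite tcoefMconst tcoefM //.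
apply: kendP => y; rewrite conv_kendE [LHS]HS_coefM //.
apply: eq_conv => b c E.
by rewrite tcoef_mk //; exact: coideal_summandl E.
Qed.

Lemma HS_kendC_series D (f : 'X_{1..p} -> A) :
  HS_series D * mkts (fun a => kendC eta (f a)) =
  mkts (fun a => kendC eta (conv (fun b c => tcoef D b (f c)) a)) * HS_series D.
Proof.
apply: tseriesP => a Da; rewrite !tcoefM //.
apply: kendP => y; rewrite !conv_kendE.
transitivity (conv (fun b c => conv (fun b1 b2 =>
    tcoef D b1 (f c) * tcoef D b2 y) b) a).
  apply: eq_conv => b c E; rewrite tcoef_mk; last exact: coideal_summandr E.
  by rewrite [LHS]HS_coefM //; exact: coideal_summandl E.
transitivity (conv (fun e b2 => conv (fun b1 c =>
    tcoef D b1 (f c) * tcoef D b2 y) e) a); last first.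
  apply: eq_conv => e d E; rewrite tcoef_mk; last exact: coideal_summandl E.
  by rewrite [RHS]convMr.
rewrite (convA (fun b1 b2 c => tcoef D b1 (f c) * tcoef D b2 y)).
rewrite (convA (fun b1 c b2 => tcoef D b1 (f c) * tcoef D b2 y)).
by apply: eq_conv => b1 e _; rewrite convC.
Qed.

(* Apply the Euler derivation to D x = D(x) D. *)
Lemma HS_log_der D (l : tseries (kend eta) Delta) :
    euler (HS_series D) = HS_series D * l ->
  forall a, exists d : der eta, der_end d = tcoef l a.
Proof.
move=> El a; suff H x y : tcoef l a (x * y) = tcoef l a x * y + x * tcoef l a y.
  by exists (Der H).
have [Da|Da] := pselect (Delta a); last first.
  by rewrite tcoef_out //= mul0r mulr0 addr0.
have [w wD Dw] := tseries_inv (HS_coef0 D).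
have evalE : euler (mkts (fun b => kendC eta (tcoef D b x)) : tseries _ Delta) =
    mkts (fun b => kendC eta (conv (fun c d => tcoef D c (tcoef l d x)) b)).
  apply: tseriesP => b Db; rewrite tcoef_weight !tcoef_mk //.
  rewrite -rmorphMn; congr (kendC eta _).
  have -> : tcoef D b x *+ mdeg b = tcoef (HS_series D * l) b x.
    by rewrite -El tcoef_weight; elim: (mdeg b) => // n IH; rewrite !mulrS IH.
  by rewrite tcoefM // conv_kendE.
(* The left side becomes D l x and the right side D l(x) + D x l; cancelling D leaves l x = l(x) + x
   l, which is evaluated at y. *)
have /(congr1 (fun f => w * f)) := congr1 (fun f => euler f) (HS_kendC D x).
rewrite /= !tweightM; try exact: mdegD.
rewrite tweight_const ?mulr0 ?addr0; last exact: mdegD.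
rewrite evalE -HS_kendC_series El [X in _ + X]mulrA -HS_kendC.
rewrite mulrDr !mulrA wD !mul1r => /(congr1 (fun f : tseries (kend eta) Delta => tcoef f a y)).
by rewrite /= tcoefMconst tcoefD tcoef_constM tcoef_mk // kendDE.
Qed.

End HSOperators.

Section Construction.
Variables (k A : comPzRingType) (eta : {rmorphism k -> A}).
Hypothesis divA : forall n, exists x : A, x * n.+1%:R = 1.
Variables (R : alg_over eta) (nabla : LR_map R).

Let P : pzRingType := (kend eta * R)%type.

Definition pair_map (a : A) : P := (kendC eta a, alg_map R a).

Lemma pair_map_is_zmod_morphism : zmod_morphism pair_map.
Proof. by move=> a b; rewrite /pair_map !rmorphB. Qed.
Lemma pair_map_is_monoid_morphism : monoid_morphism pair_map.
Proof. by split=> [|a b]; rewrite /pair_map ?rmorph1 ?rmorphM. Qed.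
HB.instance Definition _ := GRing.isZmodMorphism.Build A P pair_map
  pair_map_is_zmod_morphism.
HB.instance Definition _ := GRing.isMonoidMorphism.Build A P pair_map
  pair_map_is_monoid_morphism.

Definition der_graph (x : P) := exists d : der eta, x = (der_end d, nabla d).

Lemma lr_map0 : nabla 0 = 0.
Proof.
have := lr_linear nabla 1 0 0; rewrite scale1r addr0 rmorph1 mul1r => E.
by apply: (addrI (nabla 0)); rewrite addr0 -E.
Qed.

Lemma lr_mapD d d' : nabla (d + d') = nabla d + nabla d'.
Proof. by rewrite -[d]scale1r lr_linear rmorph1 mul1r scale1r. Qed.

Lemma lr_mapZ a d : nabla (a *: d) = alg_map R a * nabla d.
Proof. by rewrite -[a *: d]addr0 lr_linear lr_map0 addr0. Qed.

Lemma der_graph_submod : left_submod pair_map der_graph.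
Proof.
split=> [|_ _ [d ->] [d' ->]|a _ [d ->]].
- by exists 0; rewrite lr_map0.
- by exists (d + d'); rewrite lr_mapD.
- by exists (a *: d); rewrite lr_mapZ.
Qed.

Lemma der_graph_bracket x y :
  der_graph x -> der_graph y -> der_graph (x * y - y * x).
Proof. by move=> [d ->] [d' ->]; exists (der_bracket d d'); rewrite lr_bracket. Qed.

Lemma der_graph_base x y :
  der_graph x -> base pair_map y -> base pair_map (x * y - y * x).
Proof.
move=> [d ->] [a ->]; exists (der_end d a); congr pair.
  by apply: kendP => z /=; rewrite derM addrK.
by rewrite /= lr_leibniz [_ + alg_map _ _]addrC addrK.
Qed.

(** Pair each derivation in D^-1 E(D) with its image under [nabla] and solve E(r) = r l in the
    product ring; the first projection solves the equation of D. *)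
Lemma HS_lift p (Delta : coideal p) (D : HS eta Delta) :
  exists2 r : tseries P Delta, expL der_graph r & tmap fst r = D.
Proof.
have [w wD Dw] := tseries_inv (HS_coef0 D).
pose h := w * euler (HS_series D).
have Eh : euler (HS_series D) = HS_series D * h by rewrite mulrA Dw mul1r.
have h0 := euler_eq_const0 (HS_coef0 D) Eh.
have [d dE] := boolp.choice (HS_log_der Eh).
pose l : tseries P Delta := mkts (fun a => (der_end (d a), nabla (d a))).
have Ll : tin der_graph l.
  move=> a; rewrite tcoef_mkE; case: asboolP => _; first by exists (d a).
  by case: der_graph_submod.
have l0 : tcoef l 0%MM = 0.
  rewrite tcoef_mk; last exact: coideal0.
  suff -> : d 0%MM = 0 by rewrite lr_map0.
  by apply: derP => x; rewrite dE h0.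
have lh : tmap fst l = h.
  by apply: tseriesP => a Da; rewrite tcoef_map tcoef_mk //= dE.
have [r r0 Er] := euler_eq_exists pair_map divA 1 l0.
exists r; first by split=> //; exists l.
apply: (euler_eq_unique (kendC eta) divA h0 _ (HS_coef0 D) _ Eh).
  by rewrite tcoef_map r0.
by rewrite -tmap_weight Er rmorphM /= lh.
Qed.

(** The first projections determine the first components of the logarithmic derivatives, and an
    element of a graph is determined by its first component. *)
Lemma expL_fst_inj p (Delta : coideal p) (r r' : tseries P Delta) :
  expL der_graph r -> expL der_graph r' -> tmap fst r = tmap fst r' -> r = r'.
Proof.
move=> [r0 [l Ll Er]] [r0' [l' Ll' Er']] rr'.
have l0 := euler_eq_const0 r0 Er.
suff ll' : l' = l.
  by apply: (euler_eq_unique pair_map divA l0 r0 r0' Er); rewrite -ll'.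
have [w wr _] : exists2 w, w * tmap fst r = 1 & tmap fst r * w = 1.
  by apply: tseries_inv; rewrite tcoef_map r0.
have fll : tmap fst l = tmap fst l'.
  rewrite -[tmap fst l]mul1r -[tmap fst l']mul1r -wr -!mulrA.
  by rewrite {2}rr' -!rmorphM -Er -Er' /= !tmap_weight rr'.
apply: tseriesE => a; have := congr1 (fun f => tcoef f a) fll.
rewrite !tcoef_map; have [d ->] := Ll a; have [d' ->] := Ll' a.
by move=> /= dd'; rewrite (_ : d = d') //; apply: derP => x; rewrite dd'.
Qed.

Definition HS_lift_series p (Delta : coideal p) (D : HS eta Delta) :
  tseries P Delta := s2val (cid2 (HS_lift D)).

Lemma HS_lift_expL p (Delta : coideal p) (D : HS eta Delta) :
  expL der_graph (HS_lift_series D).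
Proof. exact: s2valP (cid2 (HS_lift D)). Qed.

Lemma HS_lift_fst p (Delta : coideal p) (D : HS eta Delta) :
  tmap fst (HS_lift_series D) = D.
Proof. exact: s2valP' (cid2 (HS_lift D)). Qed.

Lemma HS_lift_unique p (Delta : coideal p) (D : HS eta Delta) r :
  expL der_graph r -> tmap fst r = D -> HS_lift_series D = r.
Proof.
move=> rL rD; apply: expL_fst_inj => //; first exact: HS_lift_expL.
by rewrite HS_lift_fst.
Qed.

Definition LR_series p (Delta : coideal p) (D : HS eta Delta) : tseries R Delta :=
  tmap snd (HS_lift_series D).

Lemma LR_series_coef0 p (Delta : coideal p) (D : HS eta Delta) :
  tcoef (LR_series D) 0%MM = 1.
Proof. by rewrite tcoef_map; have [-> _] := HS_lift_expL D. Qed.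

Lemma LR_series_mul p (Delta : coideal p) (D E : HS eta Delta) :
  LR_series (HS_mul D E) = LR_series D * LR_series E.
Proof.
rewrite -rmorphM; congr tmap; apply: HS_lift_unique.
  apply: (expLM divA der_graph_submod der_graph_bracket); exact: HS_lift_expL.
by rewrite rmorphM /= !HS_lift_fst.
Qed.

(** The conjugate of [a] by the lift has coefficients in the diagonal copy of A. Its first
    projection is D(a), and A embeds in End_k(A) (evaluate at 1), so its second projection is D(a)
    too. *)
Lemma LR_series_leibniz p (Delta : coideal p) (D : HS eta Delta) (a : A) :
  LR_series D * tconst Delta (alg_map R a) =
  mkts (fun b => alg_map R (tcoef D b a)) * LR_series D.
Proof.
set r := HS_lift_series D; have rL : expL der_graph r := HS_lift_expL D.
have [w wr rw] := tseries_inv rL.1.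
pose y := r * tconst Delta (pair_map a) * w.
have ry : r * tconst Delta (pair_map a) = y * r by rewrite -[RHS]mulrA wr mulr1.
have yb : tin (base pair_map) y.
  exact: (conj_base divA der_graph_base rL wr rw).
have [w' w'D Dw'] := tseries_inv (HS_coef0 D).
have y1 : tmap fst y = mkts (fun b => kendC eta (tcoef D b a)).
  rewrite -[LHS]mulr1 -[RHS]mulr1 -Dw' !mulrA -HS_kendC.
  by rewrite -HS_lift_fst -rmorphM -/r -ry rmorphM /= tmap_const.
have y2 : tmap snd y = mkts (fun b => alg_map R (tcoef D b a)).
  apply: tseriesP => b Db; have [x yx] := yb b.
  rewrite tcoef_map [RHS]tcoef_mk //.
  have : kendC eta x = kendC eta (tcoef D b a).
    have := congr1 (fun f => tcoef f b) y1.
    by rewrite tcoef_map [RHS]tcoef_mk // => <-; exact: esym (congr1 fst yx).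
  move=> /(congr1 (fun f : kend eta => f 1)) /=; rewrite !mulr1 => <-.
  exact: (congr1 (fun u : P => u.2) yx).
by rewrite -y2 -rmorphM -/r -ry rmorphM /= tmap_const.
Qed.

Lemma LR_series_subst p q (Delta : coideal p) (Omega : coideal q)
    (phi : substmap A Delta Omega) (D : HS eta Delta) :
  LR_series (HS_subst phi D) = subst_act phi (alg_map R) (LR_series D).
Proof.
transitivity (tmap snd (subst_act phi pair_map (HS_lift_series D))).
  congr tmap; apply: HS_lift_unique.
    exact: (expL_subst divA der_graph_submod der_graph_bracket der_graph_base)
      (HS_lift_expL D).
  apply: tseriesP => e Oe; rewrite tcoef_map !tcoef_mk // rmorph_sum.
  by apply: eq_bigr => a _; rewrite rmorphM -HS_lift_fst tcoef_map.
apply: tseriesP => e Oe; rewrite tcoef_map !tcoef_mk // rmorph_sum.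
by apply: eq_bigr => a _; rewrite rmorphM tcoef_map.
Qed.

Definition HS_of_LR : HS_structure R :=
  HSStructure LR_series_coef0 LR_series_mul LR_series_leibniz LR_series_subst.

(** As s^2 = 0, the series 1 + x s has logarithmic derivative x s; take x = (d, nabla d). *)
Lemma LR_series_der (d : der eta) :
  LR_series (HS_of_der d) =
  1 + tconst coideal01 (nabla d) * tvar R coideal01 ord0.
Proof.
pose x : P := (der_end d, nabla d).
pose l : tseries P coideal01 := tconst coideal01 x * tvar P coideal01 ord0.
have tmapl (S : pzRingType) (u : {rmorphism P -> S}) :
    tmap u (1 + l) = 1 + tconst coideal01 (u x) * tvar S coideal01 ord0.
  rewrite rmorphD rmorph1 rmorphM /= tmap_const; congr (_ + _ * _).
  by apply: tseriesE => a; rewrite tcoef_map !tcoef_monom rmorph_nat.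
rewrite -(tmapl _ snd); congr tmap; apply: HS_lift_unique; last exact: tmapl.
have lE a : tcoef l a = if a == U_(ord0)%MM then x else 0.
  rewrite tcoef_constM tcoef_monom; case: eqP => [->|_]; last by rewrite andbF mulr0.
  by rewrite asboolT ?mulr1 //= mnm1E eqxx.
have U0 : (0%MM == U_(ord0)%MM :> 'X_{1..1}) = false by rewrite eq_sym mnm1_eq0.
split; first by rewrite tcoefD tcoef1 eqxx lE U0 addr0.
exists l => [a|].
  by rewrite lE; case: eqP => _; [exists d | case: der_graph_submod].
rewrite raddfD -[X in euler X + _](rmorph1 (tconst coideal01)) /= tweight_const;
  last exact: mdegD.
rewrite add0r mulrDl mul1r; apply: tseriesP => a Da.
have ll : tcoef (l * l) a = 0.
  rewrite (tcoefM l l Da); apply: conv_eq0 => b c E.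
  rewrite !lE; case: eqP => [b1|]; last by rewrite mul0r.
  case: eqP => [c1|]; last by rewrite mulr0.
  by move: Da; rewrite E b1 c1 /= mnmDE !mnm1E.
rewrite tcoefD ll addr0 tcoef_weight lE.
by case: eqP => [->|_]; rewrite ?mdeg1 ?mul0rn.
Qed.

End Construction.

(** * Uniqueness of HS-structures *)

Lemma sum_bmultinom_eq (V : nmodType) p N (b : 'X_{1..p}) (F : 'X_{1..p} -> V)
    (cond : bool) : (mdeg b < N)%N ->
  \sum_(c : 'X_{1..p < N}) (if cond && (b == c) then F c else 0) =
  if cond then F b else 0.
Proof.
by move=> bN; rewrite -big_mkcond; case: cond; [exact: bsum_eq | exact: big_pred0].
Qed.

Section TruncationMap.
Variables (A : comPzRingType) (p : nat) (Delta Omega : coideal p).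
Hypothesis OD : forall a, Omega a -> Delta a.

(* The inclusion is an argument only to make the instances below inferable. *)
Definition trunc_fun of (forall a, Omega a -> Delta a) :
  tseries A Delta -> tseries A Omega := ttrunc Omega.

Lemma trunc_is_zmod_morphism : zmod_morphism (trunc_fun OD).
Proof.
by move=> f g; apply: tseriesP => a Oa; rewrite tcoefB !tcoef_trunc // tcoefB.
Qed.

Lemma trunc_is_monoid_morphism : monoid_morphism (trunc_fun OD).
Proof.
split=> [|f g]; last exact: ttruncM.
by apply: tseriesP => a Oa; rewrite tcoef_trunc // !tcoef1.
Qed.

HB.instance Definition _ := GRing.isZmodMorphism.Build
  (tseries A Delta) (tseries A Omega) (trunc_fun OD) trunc_is_zmod_morphism.
HB.instance Definition _ := GRing.isMonoidMorphism.Build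
  (tseries A Delta) (tseries A Omega) (trunc_fun OD) trunc_is_monoid_morphism.

Program Definition trunc_subst := @SubstMap A p p Delta Omega (trunc_fun OD) _ _.
Next Obligation.
by apply: tseriesP => b Ob; rewrite tcoef_trunc // !tcoef_const.
Qed.
Next Obligation.
rewrite tcoef_trunc; last exact: coideal0.
by rewrite tcoef_monom eq_sym mnm1_eq0 andbF.
Qed.

Lemma trunc_substE (R : pzRingType) (iota : {rmorphism A -> R})
    (r : tseries R Delta) e : Omega e ->
  tcoef (subst_act trunc_subst iota r) e = tcoef r e.
Proof.
move=> Oe; rewrite tcoef_mk // -[RHS](sum_bmultinom_eq (tcoef r) true (ltnSn _)).
apply: eq_bigr => b _; rewrite tcoef_trunc // tcoef_monom asboolT /=; last exact: OD.
by case: eqP => _; rewrite ?rmorph1 ?mul1r // rmorph0 mul0r.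
Qed.

End TruncationMap.

Section Doubling.
Variables (A : comPzRingType) (p : nat) (Delta : coideal p).

Definition double_fun (f : tseries A Delta) : tseries A Delta :=
  mkts (fun a => tcoef f a *+ 2 ^ mdeg a).

Lemma tcoef_double f a : tcoef (double_fun f) a = tcoef f a *+ 2 ^ mdeg a.
Proof. by rewrite tcoef_mkE; case: asboolP => // Da; rewrite tcoef_out ?mul0rn. Qed.

Lemma double_is_zmod_morphism : zmod_morphism double_fun.
Proof.
by move=> f g; apply: tseriesE => a; rewrite tcoefB !tcoef_double tcoefB mulrnBl.
Qed.

Lemma double_is_monoid_morphism : monoid_morphism double_fun.
Proof.
split=> [|f g]; apply: tseriesP => a Da; rewrite tcoef_double.
  by rewrite !tcoef1; case: eqP => [->|_]; rewrite ?mdeg0 ?mul0rn.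
rewrite !tcoefM // /conv -sumrMnl; apply: eq_bigr => -[b c] /= /eqP E.
have -> : (2 ^ mdeg a = 2 ^ mdeg b * 2 ^ mdeg c)%N by rewrite {1}E mdegD expnD.
by rewrite !tcoef_double mulrnA mulrnAl mulrnAr mulrnAC.
Qed.

HB.instance Definition _ := GRing.isZmodMorphism.Build
  (tseries A Delta) (tseries A Delta) double_fun double_is_zmod_morphism.
HB.instance Definition _ := GRing.isMonoidMorphism.Build
  (tseries A Delta) (tseries A Delta) double_fun double_is_monoid_morphism.

Program Definition double_subst := @SubstMap A p p Delta Delta double_fun _ _.
Next Obligation.
apply: tseriesE => b; rewrite tcoef_double !tcoef_const.
by case: eqP => [->|_]; rewrite ?mdeg0 ?mul0rn.
Qed.
Next Obligation.
by rewrite tcoef_double tcoef_monom eq_sym mnm1_eq0 andbF mul0rn.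
Qed.

Lemma double_substE (R : pzRingType) (iota : {rmorphism A -> R})
    (r : tseries R Delta) e :
  tcoef (subst_act double_subst iota r) e = tcoef r e *+ 2 ^ mdeg e.
Proof.
have [De|De] := pselect (Delta e); last by rewrite !tcoef_out ?mul0rn.
rewrite tcoef_mk // -[RHS](sum_bmultinom_eq
  (fun b => tcoef r b *+ 2 ^ mdeg e) true (ltnSn _)).
apply: eq_bigr => b _; rewrite tcoef_double tcoef_monom asboolT //=.
case: eqP => _; last by rewrite mul0rn rmorph0 mul0r.
by rewrite rmorphMn rmorph1 mulrnAl mul1r.
Qed.

End Doubling.

(** Here [a] is the only multi-index of top degree, so top-degree changes of a series only concern
    s^a. *)
Program Definition box p (a : 'X_{1..p}) : coideal p :=
  @Coideal p (fun b => (b <= a)%MM) _ _.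
Next Obligation. by exists a; exact: lepm_refl. Qed.
Next Obligation. exact: lepm_trans H. Qed.

Section Monomial.
Variables (A : comPzRingType) (p : nat) (a : 'X_{1..p}).
Hypothesis a0 : a != 0%MM.

Let U : 'X_{1..1} := U_(ord0)%MM.

(** The substitution s |-> s^a, multiplicative because 2a lies outside the box. The proof of a <> 0
    is an argument so that the instances below can depend on it. *)
Definition monomial_fun of (a != 0%MM) : tseries A coideal01 -> tseries A (box a) :=
  fun f => tconst (box a) (tcoef f 0%MM)
           + tconst (box a) (tcoef f U) * tmonom A (box a) a.

Lemma monomial_is_zmod_morphism : zmod_morphism (monomial_fun a0).
Proof.
move=> f g; rewrite /monomial_fun !tcoefB !rmorphB /= mulrBl.
by rewrite opprD addrACA.
Qed.

Lemma monomial_sqr : tmonom A (box a) a * tmonom A (box a) a = 0.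
Proof.
rewrite -tmonomD tmonom_out //= => /mnm_lepP aa; move/eqP: a0; apply.
apply/mnmP => i; rewrite mnm0E; apply/eqP; rewrite -leqn0.
by rewrite -(leq_add2l (a i)) addn0 -mnmDE aa.
Qed.

Lemma monomial_is_monoid_morphism : monoid_morphism (monomial_fun a0).
Proof.
split=> [|f g]; rewrite /monomial_fun.
  by rewrite !tcoef1 eqxx mnm1_eq0 rmorph1 rmorph0 mul0r addr0.
rewrite tcoefM0 (tcoefM f g (a := U)) ?conv_at1; last by rewrite /= mnm1E eqxx.
rewrite rmorphD !rmorphM /= mulrDl !mulrDr !mulrDl -!addrA; congr (_ + _).
rewrite -[X in _ = _ + (_ + X)]mulrA [tmonom A _ a * (_ * _)]mulrA.
rewrite [tmonom A _ a * _]tmulC -[X in _ = _ + (_ + _ * X)]mulrA.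
rewrite monomial_sqr !mulr0 addr0 addrC !mulrA; congr (_ + _).
by rewrite -!mulrA [tmonom A _ a * _]tmulC.
Qed.

HB.instance Definition _ := GRing.isZmodMorphism.Build
  (tseries A coideal01) (tseries A (box a)) (monomial_fun a0)
  monomial_is_zmod_morphism.
HB.instance Definition _ := GRing.isMonoidMorphism.Build
  (tseries A coideal01) (tseries A (box a)) (monomial_fun a0)
  monomial_is_monoid_morphism.

Lemma tcoef_monomial f e : box a e -> tcoef (monomial_fun a0 f) e =
  if e == 0%MM then tcoef f 0%MM else if e == a then tcoef f U else 0.
Proof.
move=> ea; rewrite tcoefD tcoef_const tcoef_constM tcoef_monom asboolT //=.
have [->|_] := eqVneq e 0%MM; first by rewrite eq_sym (negbTE a0) mulr0 addr0.
by rewrite add0r; case: eqP; rewrite ?mulr1 ?mulr0.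
Qed.

Program Definition monomial_subst :=
  @SubstMap A 1 p coideal01 (box a) (monomial_fun a0) _ _.
Next Obligation.
by rewrite /monomial_fun !tcoef_const eqxx mnm1_eq0 rmorph0 mul0r addr0.
Qed.
Next Obligation.
rewrite tcoef_monomial; last exact: coideal0.
by rewrite eqxx tcoef_monom eq_sym mnm1_eq0 andbF.
Qed.

Lemma monomial_substE (R : pzRingType) (iota : {rmorphism A -> R})
    (r : tseries R coideal01) e : box a e ->
  tcoef (subst_act monomial_subst iota r) e =
  if e == 0%MM then tcoef r 0%MM else if e == a then tcoef r U else 0.
Proof.
move=> ea; rewrite tcoef_mk //.
have D0 : coideal01 0%MM by exact: coideal0.
have DU : coideal01 U by rewrite /= mnm1E eqxx.
have [e0|e0] := eqVneq e 0%MM.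
  have N0 : (mdeg (0 : 'X_{1..1})%MM < (mdeg e).+1)%N by rewrite mdeg0.
  rewrite -[RHS](sum_bmultinom_eq (tcoef r) true N0).
  apply: eq_bigr => b _; rewrite tcoef_monomial // (introT eqP e0) tcoef_monom asboolT //=.
  by case: eqP => _; rewrite ?rmorph1 ?mul1r // rmorph0 mul0r.
have NU : (mdeg U < (mdeg e).+1)%N by rewrite mdeg1 ltnS mdeg_gt0.
rewrite -[RHS](sum_bmultinom_eq (tcoef r) (e == a) NU).
apply: eq_bigr => b _; rewrite tcoef_monomial // (negbTE e0) tcoef_monom asboolT //=.
case: (e == a); last by rewrite rmorph0 mul0r.
by case: eqP => _; rewrite ?rmorph1 ?mul1r // rmorph0 mul0r.
Qed.

End Monomial.

Section LeadingDifference.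
Variables (R : pzRingType) (p : nat) (Delta : coideal p).
Implicit Types X Y : tseries R Delta.

(** In the terms b + c = a with b and c nonzero, both degrees are below m, where the factors agree;
    only the two end terms differ. *)
Lemma mul_leading m X X' Y Y' a :
    tcoef X 0%MM = 1 -> tcoef X' 0%MM = 1 ->
    tcoef Y 0%MM = 1 -> tcoef Y' 0%MM = 1 ->
    eq_below m X X' -> eq_below m Y Y' -> (mdeg a <= m)%N -> a != 0%MM ->
  tcoef (X * Y) a - tcoef (X' * Y') a =
  (tcoef X a - tcoef X' a) + (tcoef Y a - tcoef Y' a).
Proof.
move=> X0 X0' Y0 Y0' XX YY am a0.
have [Da|Da] := pselect (Delta a); last by rewrite !tcoef_out // subrr addr0.
rewrite !tcoefM // [X in X - _]conv_ends // [X in _ - X]conv_ends // X0 X0' Y0 Y0' !mul1r !mulr1.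
set S := conv _ a; set S' := conv _ a.
have -> : S = S'.
  apply: eq_conv => b c E; case: ifPn => //; rewrite negb_or => /andP[b0 c0].
  have abc : mdeg a = (mdeg b + mdeg c)%N by rewrite E mdegD.
  rewrite XX ?YY //; apply: leq_trans am; rewrite abc.
    by rewrite -[X in (X < _)%N]add0n ltn_add2r mdeg_gt0.
  by rewrite -[X in (X < _)%N]addn0 ltn_add2l mdeg_gt0.
by rewrite [X in _ - X]addrC opprD addrA addrK opprD addrACA [RHS]addrC.
Qed.

End LeadingDifference.

(** * Comparison of two HS-structures that agree on the Id + d s *)

Section Uniqueness.
Variables (k A : comPzRingType) (eta : {rmorphism k -> A}).
Hypothesis divA : forall n, exists x : A, x * n.+1%:R = 1.
Variables (R : alg_over eta) (Psi Psi' : HS_structure R).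
Hypothesis Psi_der : forall d : der eta,
  Psi 1 coideal01 (HS_of_der d) = Psi' 1 coideal01 (HS_of_der d).

Section Degree.
Variables (p : nat) (a : 'X_{1..p}).
Hypothesis a0 : a != 0%MM.
Hypothesis IH : forall D : HS eta (box a),
  eq_below (mdeg a) (Psi p (box a) D) (Psi' p (box a) D).

(** The first possible discrepancy at s^a. By [IH] and [mul_leading] it turns products into sums,
    and doubling the variables multiplies it by 2^|a|. *)
Let delta (D : HS eta (box a)) : R :=
  tcoef (Psi p (box a) D) a - tcoef (Psi' p (box a) D) a.

Let deltaM D E : delta (HS_mul D E) = delta D + delta E.
Proof. by rewrite /delta !hs_mul (mul_leading (m := mdeg a)) // hs_coef0. Qed.

Let delta_subst D :
  delta (HS_subst (double_subst A (box a)) D) = delta D *+ 2 ^ mdeg a.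
Proof. by rewrite /delta !hs_subst !double_substE mulrnBl. Qed.

Let HS_pow n D E : HS eta (box a) := iter n (HS_mul D) E.

Let delta_pow n D E : delta (HS_pow n D E) = delta D *+ n + delta E.
Proof. by elim: n => [|n IHn] /=; rewrite ?add0r // deltaM IHn mulrS addrA. Qed.

Let HS_pow_leading n m (D D' E E' : HS eta (box a)) b :
    eq_below m D D' -> eq_below m E E' -> (mdeg b <= m)%N -> b != 0%MM ->
  tcoef (HS_pow n D E) b - tcoef (HS_pow n D' E') b =
  (tcoef D b - tcoef D' b) *+ n + (tcoef E b - tcoef E' b).
Proof.
move=> DD EE bm b0; elim: n => [|n IHn] /=; first by rewrite add0r.
rewrite (mul_leading (m := m)) ?HS_coef0 //; first by rewrite IHn mulrS addrA.
by elim: n {IHn} => //= n IHn; exact: eq_below_mul.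
Qed.

Let HS_pow_below n m (D D' E E' : HS eta (box a)) :
  eq_below m D D' -> eq_below m E E' -> eq_below m (HS_pow n D E) (HS_pow n D' E').
Proof. by move=> DD EE; elim: n => //= n IHn; exact: eq_below_mul. Qed.

(* The only multi-index of degree at least |a| in the box below a is a, so D  *)
(* and E differ by a factor Id + d s^a.                                       *)
Let delta_top (D E : HS eta (box a)) : eq_below (mdeg a) D E -> delta D = delta E.
Proof.
move=> DE; have Ba : box a a by exact: lepm_refl.
have [d dE] : exists d : der eta, der_end d = tcoef E a - tcoef D a.
  suff H (x y : A) : (tcoef E a - tcoef D a) (x * y) =
      (tcoef E a - tcoef D a) x * y + x * (tcoef E a - tcoef D a) y.
    by exists (Der H).
  have subE (f g : kend eta) z : (f - g) z = f z - g z by [].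
  rewrite !subE !HS_coefM // [X in X - _]conv_ends // [X in _ - X]conv_ends // !HS_coef0 !kend1E.
  set S := conv _ a; set S' := conv _ a.
  have -> : S = S'.
    apply: eq_conv => b c Ebc; case: ifPn => //; rewrite negb_or => /andP[b0 c0].
    have abc : mdeg a = (mdeg b + mdeg c)%N by rewrite Ebc mdegD.
    have ba : (mdeg b < mdeg a)%N.
      by rewrite abc -[X in (X < _)%N]addn0 ltn_add2l mdeg_gt0.
    have ca : (mdeg c < mdeg a)%N.
      by rewrite abc -[X in (X < _)%N]add0n ltn_add2r mdeg_gt0.
    by rewrite (DE b ba) (DE c ca).
  rewrite mulrBl mulrBr [X in _ - X]addrC opprD addrA addrK opprD addrACA.
  by rewrite addrC.
pose F := HS_subst (monomial_subst A a0) (HS_of_der d).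
have FE b : box a b -> tcoef F b =
    if b == 0%MM then 1 else if b == a then der_end d else 0.
  move=> Bb; rewrite monomial_substE // HS_coef0; case: eqP => // _.
  case: eqP => // _; rewrite tcoefD tcoef1 mnm1_eq0 add0r tcoef_constM.
  by rewrite tcoef_monom eqxx asboolT ?mulr1 //= mnm1E eqxx.
have F1 : eq_below (mdeg a) F (1 : tseries (kend eta) (box a)).
  move=> b ba; have [Bb|Bb] := pselect (box a b); last by rewrite !tcoef_out.
  rewrite FE // tcoef1; case: eqP => // _; case: eqP => // E0.
  by rewrite E0 ltnn in ba.
have <- : HS_mul D F = E.
  apply: HS_inj; apply: tseriesP => b Bb.
  have [ba|ab] := ltnP (mdeg b) (mdeg a).
    by rewrite -DE // -[HS_series D in RHS]mulr1; exact: eq_below_mul ba.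
  have -> : b = a.
    by apply/eqP; move: Bb ab => /= /submK <-; rewrite mdegD -[X in (_ <= X)%N]add0n
       leq_add2r leqn0 mdeg_eq0 => /eqP ->; rewrite add0m.
  apply: (addIr (- tcoef (HS_series D * 1) a)).
  rewrite (mul_leading (m := mdeg a)) ?HS_coef0 ?tcoef1 ?eqxx //.
  by rewrite mulr1 subrr add0r FE // (negbTE a0) eqxx subr0 dE.
suff F0 : delta F = 0 by rewrite deltaM F0 addr0.
rewrite /delta !hs_subst !monomial_substE // (negbTE a0) eqxx.
by rewrite Psi_der subrr.
Qed.

(* If D and E agree in degrees below m, then D^(2^m) phi(E) and E^(2^m) phi(D) *)
(* agree in degrees below m + 1, where phi doubles the variables.             *)
Let delta_below m (D E : HS eta (box a)) :
  (0 < m <= mdeg a)%N -> eq_below m D E -> delta D = delta E.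
Proof.
move En : (mdeg a - m)%N => n; elim: n m En D E => [|n IHn] m En D E.
  case/andP=> _ ma DE; apply: delta_top; move/eqP: En; rewrite subn_eq0 => am.
  exact: eq_belowS am DE.
case/andP=> m0 _ DE.
have ma : (m < mdeg a)%N by rewrite -subn_gt0 En.
pose phi (X : HS eta (box a)) := HS_subst (double_subst A (box a)) X.
have phiDE : eq_below m (phi E) (phi D).
  by move=> b bm; rewrite !double_substE DE.
have : delta (HS_pow (2 ^ m) D (phi E)) = delta (HS_pow (2 ^ m) E (phi D)).
  apply: (IHn m.+1) => [||b bm].
  - by rewrite subnS En.
  - by rewrite ltn0Sn.
  have [->|b0] := eqVneq b 0%MM; first by rewrite !HS_coef0.
  have [bm'|mb] := ltnP (mdeg b) m; first exact: (HS_pow_below _ DE phiDE).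
  have bE : mdeg b = m by apply/eqP; rewrite eqn_leq mb andbT -ltnS.
  (* In degree m the difference is 2^m (D_b - E_b) + 2^m (E_b - D_b) = 0; this is why the power 2^m
     is taken. *)
  apply: subr0_eq; rewrite (@HS_pow_leading _ m) ?bE //.
  by rewrite !double_substE bE -mulrnBl -mulrnDl addrA subrK subrr mul0rn.
rewrite !delta_pow !delta_subst; move: (delta D) (delta E) => x y H.
apply: subr0_eq.
(* H reads 2^m x + 2^|a| y = 2^m y + 2^|a| x, so x - y is killed by 2^|a| - 2^m, which is positive
   as m < |a|. *)
apply: (@mulrn_inj_div _ _ (alg_map R) divA (2 ^ mdeg a - 2 ^ m)).
  by rewrite subn_gt0 ltn_exp2l.
rewrite mul0rn mulrnBr; last by rewrite leq_exp2l // ltnW.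
rewrite !mulrnBl; apply/eqP; rewrite subr_eq0 subr_eq addrAC.
by rewrite H addrAC subrr add0r.
Qed.

Lemma HS_structure_degree D : tcoef (Psi p (box a) D) a = tcoef (Psi' p (box a) D) a.
Proof.
apply: subr0_eq; rewrite -/(delta D).
(* D and D^2 have the same constant term, so [delta_below] at m = 1 gives 2 delta(D) = delta(D). *)
apply: (addrI (delta D)); rewrite addr0 -deltaM.
apply: esym; apply: (@delta_below 1) => [|b].
  by rewrite mdeg_gt0.
by rewrite ltnS leqn0 mdeg_eq0 => /eqP ->; rewrite !HS_coef0.
Qed.

End Degree.

(** Truncation is a substitution, so the coefficient at [a] can be computed in the box below [a].
    The induction on the degree runs over all co-ideals at once, as the box changes with [a]. *)
Lemma HS_structure_unique p (Delta : coideal p) (D : HS eta Delta) :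
  Psi p Delta D = Psi' p Delta D.
Proof.
suff H n a : (mdeg a < n)%N -> forall (Delta : coideal p) (D : HS eta Delta),
    tcoef (Psi p Delta D) a = tcoef (Psi' p Delta D) a.
  by apply: tseriesE => a; exact: H (ltnSn _) _ _.
elim: n a => // n IH a an {D}Delta D.
have [->|a0] := eqVneq a 0%MM; first by rewrite !hs_coef0.
have [Da|Da] := pselect (Delta a); last by rewrite !tcoef_out.
have BD b : box a b -> Delta b by exact: coideal_le.
have Ba : box a a by exact: lepm_refl.
rewrite -(trunc_substE BD (alg_map R) (Psi p Delta D) Ba).
rewrite -(trunc_substE BD (alg_map R) (Psi' p Delta D) Ba) -!hs_subst.
apply: HS_structure_degree => // E b ba.
by apply: IH; exact: leq_trans ba an.
Qed.

End Uniqueness.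

(** * Filtrations *)

Section FiltrationTheory.
Variables (R : pzRingType) (gen : nat -> R -> Prop).
Let F := filtration gen.

Lemma filtration_ind (Q : R -> Prop) d x :
    Q 0 -> (forall y z, Q y -> Q z -> Q (y + z)) -> (forall y, Q y -> Q (- y)) ->
    (forall m y, (m <= d)%N -> weighted_product gen m y -> Q y) ->
  F d x -> Q x.
Proof.
move=> Q0 QD QN QP [s sP ->]; rewrite big_seq; apply: big_ind => // y.
case/sP=> -[m md wy]; first exact: QP md wy.
by rewrite -[y]opprK; apply: QN; exact: QP md wy.
Qed.

Lemma filtration0 d : F d 0.
Proof. by exists [::]; rewrite ?big_nil. Qed.

Lemma filtrationD d x y : F d x -> F d y -> F d (x + y).
Proof.
move=> [s sP ->] [t tP ->]; exists (s ++ t); last by rewrite big_cat.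
by move=> z; rewrite mem_cat => /orP[/sP|/tP].
Qed.

Lemma filtrationN d x : F d x -> F d (- x).
Proof.
move=> [s sP ->]; exists (map -%R s); last by rewrite big_map sumrN.
by move=> _ /mapP[y /sP Py ->]; rewrite opprK; case: Py; [right | left].
Qed.

Lemma filtration_product d m x :
  (m <= d)%N -> weighted_product gen m x -> F d x.
Proof.
move=> md wx; exists [:: x]; last by rewrite big_seq1.
by move=> y; rewrite inE => /eqP ->; left; exists m.
Qed.

Lemma filtrationS d e x : (d <= e)%N -> F d x -> F e x.
Proof.
move=> de [s sP ->]; exists s => // y /sP[] [m md wy]; [left|right];
  by exists m => //; exact: leq_trans md de.
Qed.

Lemma filtration_gen n x : gen n x -> F n x.
Proof.
move=> gx; apply: (@filtration_product n (n + 0)); first by rewrite addn0.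
by rewrite -[x]mulr1; apply: WProdCons gx _; exact: WProdNil.
Qed.

Lemma weighted_productM m n x y : weighted_product gen m x ->
  weighted_product gen n y -> weighted_product gen (m + n) (x * y).
Proof.
move=> wx wy; elim: wx => [|i u j v gu _ IH]; first by rewrite mul1r.
by rewrite -addnA -mulrA; exact: WProdCons.
Qed.

Lemma filtrationM d e x y : F d x -> F e y -> F (d + e) (x * y).
Proof.
move=> + Fy; apply: (filtration_ind (Q := fun x => F (d + e) (x * y)))
  => [|u v Fu Fv|u Fu|m u md wu].
- by rewrite mul0r; exact: filtration0.
- by rewrite mulrDl; exact: filtrationD.
- by rewrite mulNr; exact: filtrationN.
move: Fy; apply: (filtration_ind (Q := fun y => F (d + e) (u * y)))
  => [|v w Fv Fw|v Fv|n v ne wv].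
- by rewrite mulr0; exact: filtration0.
- by rewrite mulrDr; exact: filtrationD.
- by rewrite mulrN; exact: filtrationN.
by apply: (@filtration_product _ (m + n)); [exact: leq_add|exact: weighted_productM].
Qed.

Lemma filtration1 d : F d 1.
Proof. by apply: (@filtration_product _ 0) => //; exact: WProdNil. Qed.

End FiltrationTheory.

Lemma filtration_map (R S : pzRingType) (u : {rmorphism R -> S})
    (gen : nat -> R -> Prop) (gen' : nat -> S -> Prop) :
    (forall n x, gen n x -> filtration gen' n (u x)) ->
  forall d x, filtration gen d x -> filtration gen' d (u x).
Proof.
move=> genu d x; apply: (filtration_ind (Q := fun x => filtration gen' d (u x)))
  => [|y z Fy Fz|y Fy|m y md wy].
- by rewrite rmorph0; exact: filtration0.
- by rewrite rmorphD; exact: filtrationD.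
- by rewrite rmorphN; exact: filtrationN.
apply: filtrationS md _; elim: wy => [|i v j w gv _ IH].
  by rewrite rmorph1; exact: filtration1.
by rewrite rmorphM; apply: filtrationM => //; exact: genu.
Qed.

(** * Images of HS-structures under algebra maps, and the order of the coefficients of
    [LR_series] *)

Section AlgebraMorphisms.
Variables (k A : comPzRingType) (eta : {rmorphism k -> A}).

Program Definition alg_mor_id (R : alg_over eta) : alg_mor R R :=
  @AlgMor k A eta R R idfun _.

Program Definition alg_mor_comp (R S T : alg_over eta)
  (g : alg_mor S T) (f : alg_mor R S) : alg_mor R T :=
  @AlgMor k A eta R T (g \o f) _.
Next Obligation. by rewrite /= !alg_funE. Qed.

Section Transport.
Variables (R S : alg_over eta) (f : alg_mor R S) (Psi : HS_structure R).

Let fPsi p (Delta : coideal p) (D : HS eta Delta) : tseries S Delta :=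
  tmap f (Psi p Delta D).

Let fPsi_coef0 p (Delta : coideal p) (D : HS eta Delta) :
  tcoef (fPsi D) 0%MM = 1.
Proof. by rewrite tcoef_map hs_coef0 rmorph1. Qed.

Let fPsi_mul p (Delta : coideal p) (D E : HS eta Delta) :
  fPsi (HS_mul D E) = fPsi D * fPsi E.
Proof. by rewrite -rmorphM -hs_mul. Qed.

Let fPsi_leibniz p (Delta : coideal p) (D : HS eta Delta) (a : A) :
  fPsi D * tconst Delta (alg_map S a) =
  mkts (fun b => alg_map S (tcoef D b a)) * fPsi D.
Proof.
rewrite -(alg_funE f) -tmap_const -rmorphM hs_leibniz rmorphM; congr (_ * _).
by apply: tseriesP => b Db; rewrite tcoef_map !tcoef_mk // alg_funE.
Qed.

Let fPsi_subst p q (Delta : coideal p) (Omega : coideal q)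
    (phi : substmap A Delta Omega) (D : HS eta Delta) :
  fPsi (HS_subst phi D) = subst_act phi (alg_map S) (fPsi D).
Proof.
apply: tseriesP => e Oe; rewrite tcoef_map hs_subst !tcoef_mk // rmorph_sum.
by apply: eq_bigr => a _; rewrite rmorphM alg_funE tcoef_map.
Qed.

Definition HS_structure_map : HS_structure S :=
  HSStructure fPsi_coef0 fPsi_mul fPsi_leibniz fPsi_subst.

End Transport.

Hypothesis divA : forall n, exists x : A, x * n.+1%:R = 1.

(** From E(r) = r l, |a| r_a is a sum of products r_b l_c with b + c = a and c <> 0. By induction
    r_b has order at most |b|, and l_c lies in the image of sigma, so its order is at most 1 <= |c|.
    Dividing by |a| multiplies by an element of A, of order 0. *)
Lemma LR_filtration_coef (U : alg_over eta) (sigma : LR_map U)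
    p (Delta : coideal p) (D : HS eta Delta) a :
  LR_filtration sigma (mdeg a) (tcoef (LR_series divA sigma D) a).
Proof.
have FN d : left_submod (alg_map U) (LR_filtration sigma d).
  split=> [|x y|c x Fx]; [exact: filtration0|exact: filtrationD|].
  rewrite -[d]add0n; apply: filtrationM => //; apply: filtration_gen.
  by left; split=> //; exists c.
have [r0 [l Ll Er]] := HS_lift_expL divA sigma D.
have l0 := euler_eq_const0 r0 Er.
suff H n b : (mdeg b < n)%N ->
    LR_filtration sigma (mdeg b) (tcoef (LR_series divA sigma D) b).
  exact: H (ltnSn _).
elim: n b => // n IH {}a; rewrite ltnS => an.
have [Da|Da] := pselect (Delta a); last by rewrite tcoef_out //; case: (FN (mdeg a)).
have [->|a0] := eqVneq a 0%MM; first by rewrite LR_series_coef0; exact: filtration1.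
apply: (left_submod_div divA (FN _) (n := mdeg a)); first by rewrite mdeg_gt0.
rewrite -tcoef_weight -tmap_weight Er rmorphM tcoefM //.
apply: (left_submod_conv (FN _)) => b c E.
have [->|c0] := eqVneq c 0%MM.
  by rewrite [X in _ * X]tcoef_map l0 rmorph0 mulr0; case: (FN (mdeg a)).
rewrite {1}E mdegD; apply: filtrationM.
  apply: IH; apply: leq_trans an.
  by rewrite E mdegD -[X in (X < _)%N]addn0 ltn_add2l mdeg_gt0.
rewrite tcoef_map; have [d ->] := Ll c; apply: (@filtrationS _ _ 1).
  by rewrite mdeg_gt0.
by apply: filtration_gen; right; split=> //; exists d.
Qed.

End AlgebraMorphisms.

(** * The inverse of kappa *)

Theorem theorem2p2p7
  (k : comNzRingType) (ratk : {rmorphism rat -> k})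
  (A : comPzRingType) (eta : {rmorphism k -> A})
  (ULR : alg_over eta) (sigma : LR_map ULR) (ULR_univ : is_LR_envelope sigma)
  (UHS : alg_over eta) (Upsilon : HS_structure UHS)
  (UHS_univ : is_HS_envelope Upsilon)
  (nablaHS : der eta -> UHS)
  (nablaHS_def : forall delta : der eta,
     Upsilon 1 coideal01 (HS_of_der delta) =
     1 + tconst coideal01 (nablaHS delta) * tvar UHS coideal01 ord0)
  (kappa : alg_mor ULR UHS)
  (kappa_def : forall delta : der eta, kappa (sigma delta) = nablaHS delta) :
  filtered_iso (LR_filtration sigma) (HS_filtration Upsilon) kappa.
Proof.
have divA n : exists x : A, x * n.+1%:R = 1.
  exists (eta (ratk n.+1%:R^-1)).
  have -> : n.+1%:R = eta (ratk n.+1%:R) by rewrite !rmorph_nat.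
  rewrite -!rmorphM mulVf; first by rewrite !rmorph1.
  by rewrite Num.Theory.pnatr_eq0.
pose Psi := HS_of_LR divA sigma.
have [g [gPsi _]] := UHS_univ ULR Psi.
have gE p (Delta : coideal p) (D : HS eta Delta) a :
    g (tcoef (Upsilon p Delta D) a) = tcoef (LR_series divA sigma D) a.
  by rewrite -tcoef_map; congr tcoef; exact: gPsi.
have U1 : coideal01 U_(ord0)%MM by rewrite /= mnm1E eqxx.
have coefU (S : alg_over eta) (x : S) :
    tcoef (1 + tconst coideal01 x * tvar S coideal01 ord0) U_(ord0)%MM = x.
  rewrite tcoefD tcoef1 mnm1_eq0 add0r tcoef_constM tcoef_monom asboolT //.
  by rewrite eqxx mulr1.
have g_nabla d : g (nablaHS d) = sigma d.
  by rewrite -(coefU UHS (nablaHS d)) -nablaHS_def gE LR_series_der coefU.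
have nabla_coef d : nablaHS d = tcoef (Upsilon 1 coideal01 (HS_of_der d)) U_(ord0)%MM.
  by rewrite nablaHS_def coefU.
exists g; split.
(* g kappa and the identity both fix sigma. *)
- have [f [_ f_unique]] := ULR_univ ULR sigma.
  move=> x; transitivity (f x); last first.
    by apply: esym; apply: (f_unique (alg_mor_id ULR)).
  by apply: (f_unique (alg_mor_comp g kappa)) => d; rewrite /= kappa_def g_nabla.
- have [f [_ f_unique]] := UHS_univ UHS Upsilon.
  (* Transporting [Psi] along kappa gives Upsilon, as both take the value 1 + nablaHS(d) s at Id + d
     s; hence kappa g fixes Upsilon. *)
  have kPsi p (Delta : coideal p) (D : HS eta Delta) :
      HS_structure_map kappa Psi p Delta D = Upsilon p Delta D.
    apply: (HS_structure_unique divA) => d.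
    rewrite nablaHS_def /= LR_series_der rmorphD rmorph1 rmorphM /= tmap_const.
    rewrite kappa_def; congr (_ + _ * _); apply: tseriesE => a.
    by rewrite tcoef_map !tcoef_monom rmorph_nat.
  move=> x; transitivity (f x); last first.
    apply: esym; apply: (f_unique (alg_mor_id UHS)) => p Delta D.
    by apply: tseriesP => a Da; rewrite tcoef_mk.
  apply: (f_unique (alg_mor_comp kappa g)) => p Delta D; rewrite -[RHS]kPsi.
  by apply: tseriesP => a Da; rewrite tcoef_mk //= gE [RHS]tcoef_map.
- apply: filtration_map => n x [[-> [a ->]]|[-> [d ->]]].
    by rewrite alg_funE; apply: filtration_gen; left; split=> //; exists a.
  rewrite kappa_def nabla_coef; apply: filtration_gen; right.
  by exists 1%N, coideal01, (HS_of_der d), U_(ord0)%MM; rewrite mdeg1.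
- apply: filtration_map => n x [[-> [a ->]]|[p [Delta [D [b [Db -> ->]]]]]].
    by rewrite alg_funE; apply: filtration_gen; left; split=> //; exists a.
  by rewrite gE; exact: LR_filtration_coef.
Qed.
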